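(* Let $X\sim F$ be a real-valued random variable with all moments finite, i.e. $\mathbf{E}[|X|^k]<\infty$ for all $k=1,2,\ldots$, whose distribution $F$ is absolutely continuous with density $f=F'$. Suppose that $f$ is symmetric on $\mathbb{R}$ (i.e. $f(-x)=f(x)$) and that, for some $x_0>1$, $f$ is continuous and strictly positive outside the interval $(-x_0,x_0)$, and $$\int_{|x|\ge x_0}\frac{-\ln f(x)}{x^2\,\ln|x|}\,\mathrm{d}x=\infty .$$ Suppose further that the function $x\mapsto \dfrac{-\ln f(x)}{\ln x}$ is monotone increasing on $[x_0,\infty)$ and tends to $\infty$ as $x\to\infty$. Then $X\sim F$ satisfies Carleman's condition (Hamburger case), $\sum_{k=1}^\infty (\mathbf{E}[X^{2k}])^{-1/(2k)}=\infty$, and hence $X$ is M-determinate (on $\mathbb{R}$). Moreover, $X^2$ is M-determinate on $\mathbb{R}_+=[0,\infty)$.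
   Context: A random variable with values in $\mathbb{R}$ and all moments finite is called M-determinate on $\mathbb{R}$ if its distribution is the only probability distribution on $\mathbb{R}$ having its moment sequence. A random variable with values in $\mathbb{R}_+=[0,\infty)$ and all moments finite is called M-determinate on $\mathbb{R}_+$ if its distribution is the only probability distribution on $\mathbb{R}_+$ having its moment sequence. ''Monotone increasing'' is understood in the usual sense of non-decreasing. *)

(* Defs.v *)
From HB Require Import structures.
From mathcomp Require Import all_boot all_order all_algebra.
From mathcomp Require Import all_classical all_reals all_analysis measurable_realfun.

Set Implicit Arguments.
Unset Strict Implicit.
Unset Printing Implicit Defensive.

Import Order.TTheory GRing.Theory Num.Theory.
Import numFieldNormedType.Exports.

Local Open Scope classical_set_scope.
Local Open Scope ring_scope.

Definition finite_moments d (T : measurableType d) (R : realType)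
    (P : probability T R) (X : T -> R) : Prop :=
  forall k : nat, ('E_P[fun w => (`|X w| ^+ k)%R] < +oo)%E.

Definition same_moments d (T : measurableType d) d' (T' : measurableType d')
    (R : realType) (P : probability T R) (X : T -> R)
    (Q : probability T' R) (Y : T' -> R) : Prop :=
  forall k : nat, ('E_P[fun w => (X w ^+ k)%R] = 'E_Q[fun w => (Y w ^+ k)%R])%E.

(* f is a (pointwise nonnegative, Borel) version of the Lebesgue density of the
   distribution of X. *)
Definition has_density d (T : measurableType d) (R : realType)
    (P : probability T R) (X : {RV P >-> R}) (f : R -> R) : Prop :=
  [/\ measurable_fun [set: R] f,
      forall x, 0 <= f x &
      forall A : set R, measurable A ->
        distribution P X A =
        (\int[@lebesgue_measure R]_(x in A) (f x)%:E)%E].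

(* The competing distributions range over Borel probability measures Q on R;
   their moments are those of the identity under Q. *)
Definition M_determinate d (T : measurableType d) (R : realType)
    (P : probability T R) (X : {RV P >-> R}) : Prop :=
  finite_moments P X /\
  forall Q : probability (measurableTypeR R) R,
    finite_moments Q (fun x : R => x) ->
    same_moments Q (fun x : R => x) P X ->
    forall A : set R, measurable A -> Q A = distribution P X A.

(* Probability distributions on [0, +oo[ are represented as Borel probability
   measures Q on R with Q [0, +oo[ = 1. *)
Definition M_determinate_nneg d (T : measurableType d) (R : realType)
    (P : probability T R) (X : {RV P >-> R}) : Prop :=
  [/\ forall w, 0 <= X w,
      finite_moments P X &
      forall Q : probability (measurableTypeR R) R,
        Q (`[0, +oo[%classic : set R) = 1%E ->
        finite_moments Q (fun x : R => x) ->
        same_moments Q (fun x : R => x) P X ->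
        forall A : set R, measurable A -> Q A = distribution P X A].

(* m ^ (-1/(2k)) is written as the extended inverse of m ^ (1/(2k)), so that a
   zero moment gives a term +oo and an infinite one a term 0; `^ with a negative
   exponent has the opposite values there. *)
Definition Carleman_Hamburger d (T : measurableType d) (R : realType)
    (P : probability T R) (X : {RV P >-> R}) : Prop :=
  (\sum_(1 <= k <oo)
     ('E_P[fun w => (X w ^+ (2 * k))%R] `^ (2 * k)%:R^-1%R)^-1 = +oo)%E.

Arguments has_density {d T R} P X f.
Arguments M_determinate {d T R} P X.
Arguments M_determinate_nneg {d T R} P X.
Arguments Carleman_Hamburger {d T R} P X.

(* Main.v *)
Require Import Defs.
From HB Require Import structures.
From mathcomp Require Import all_boot all_order all_algebra.
From mathcomp Require Import all_classical all_reals all_analysis measurable_realfun.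
From mathcomp Require Import ring lra zify.

Import Order.TTheory GRing.Theory Num.Theory.
Import numFieldNormedType.Exports.

Local Open Scope classical_set_scope.
Local Open Scope ring_scope.

Set Implicit Arguments.
Unset Strict Implicit.
Unset Printing Implicit Defensive.

(* With [q = - ln f / ln] and [z k = inf {x | 2 k + 4 <= q x}] one has
   [x ^ (2 k + 2) * f x = O(z 0 ^ 2 * ... * z (k - 1) ^ 2)], so the same product
   bounds [E X ^ (2 k)]. Since [q x <= 4 + 2 * #{k | z k <= x}], Tonelli turns the
   divergence of the logarithmic integral into [\sum 1 / z k = oo]; Carleman's
   condition is then immediate. For determinacy, the difference of the cosine
   transforms of two solutions of the moment problem has all derivatives zero at
   the origin and derivatives bounded up to a constant by the products
   [z 0 * z 0 * z 1 * z 1 * ...], hence vanishes by Bang's elementary proof of the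
   Denjoy-Carleman theorem. Cosines determine the distribution function because
   they form an algebra and the sign function is the limit of the iterates of
   [u |-> (3 u - u ^ 3) / 2]. For [X ^ 2], the same is applied to the law of the
   square root of a solution, where only the even moments, hence only the cosines
   without phase, are available. *)

(** * Bang's elementary form of the Denjoy-Carleman theorem *)

Lemma sum_half_powers (R : realFieldType) (m : nat) :
  \sum_(j < m) 2^-1 ^+ j <= 2 :> R.
Proof.
suff -> : \sum_(j < m) 2^-1 ^+ j = 2 - 2 * 2^-1 ^+ m :> R.
  by rewrite gerBl mulr_ge0// exprn_ge0// invr_ge0.
elim: m => [|m IH]; first by rewrite big_ord0 expr0 mulr1 subrr.
by rewrite big_ord_recr/= IH exprS; field.
Qed.

Section bang.
Context {R : realType}.
(** [G n] stands for the [n]-th derivative of [G 0], bounded by [M n], whose successive ratios [w]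
    are non-decreasing. Differentiability enters only through the inequality [G_taylor], whose
    remainder carries no factorial. *)
Variables (w M : nat -> R) (G : nat -> R -> R).
Hypothesis w_gt0 : forall n, 0 < w n.
Hypothesis w_nd : {homo w : m n / (m <= n)%N >-> m <= n}.
Hypothesis M0_ge0 : 0 <= M 0%N.
Hypothesis MS : forall n, M n.+1 = M n * w n.
Hypothesis G_le : forall n t, `|G n t| <= M n.
Hypothesis G_taylor : forall n m t h,
  `|G n (t + h) - \sum_(j < m) G (n + j)%N t * (h ^+ j / j`!%:R)| <=
  `|h| ^+ m * M (n + m)%N.

Let M_ge0 n : 0 <= M n.
Proof. by elim: n => // n IH; rewrite MS mulr_ge0// ltW. Qed.

Let M_ratio K n j : (n + j <= K.+1)%N -> M (n + j)%N <= M n * w K ^+ j.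
Proof.
elim: j => [|j IH] njK; first by rewrite addn0 expr0 mulr1.
rewrite addnS MS exprSr mulrA ler_pM//; first exact: ltW.
  by apply: IH; rewrite (leq_trans _ njK)// addnS.
by apply: w_nd; rewrite -ltnS -addnS.
Qed.

Let pow_fact (h : R) j : `|h| ^+ j / j`!%:R <= `|h| ^+ j.
Proof.
by rewrite ler_pdivrMr ?ltr0n ?fact_gt0// ler_peMr ?exprn_ge0// ler1n fact_gt0.
Qed.

(** For [n > K] the global bound [G_le] suffices, since [b * 2 ^ n >= 1]. For [n <= K], expansion up
    to order [K + 1] meets only ratios at most [w K], so the term of degree [j] in [h], remainder
    included, is at most [b * 2 ^ n * M n * (2 * w K * |h|) ^ j]. As [2 * w K * |h| <= 1 / 2], these
    terms sum to at most twice the first. *)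
Lemma bang_step K (b t h : R) : 0 <= b -> 1 <= b * 2 ^+ K.+1 ->
  (forall n, `|G n t| <= b * 2 ^+ n * M n) -> `|h| <= (4 * w K)^-1 ->
  forall n, `|G n (t + h)| <= 2 * b * 2 ^+ n * M n.
Proof.
move=> b0 bK Gt hK n.
have M_le k : (K.+1 <= k)%N -> M k <= b * 2 ^+ k * M k.
  move=> Kk; rewrite ler_peMl// (le_trans bK)// ler_wpM2l//.
  by rewrite ler_weXn2l// ler1n.
have [Kn|nK] := leqP K.+1 n.
  rewrite (le_trans (G_le _ _))// (le_trans (M_le _ Kn))//.
  by rewrite ler_wpM2r// -mulrA ler_peMl ?ler1n// mulr_ge0// exprn_ge0.
set m := (K.+1 - n)%N.
have nm : (n + m)%N = K.+1 by rewrite subnKC// ltnW.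
have term j : (j <= m)%N ->
    b * 2 ^+ (n + j) * M (n + j)%N * `|h| ^+ j <=
    b * 2 ^+ n * M n * 2^-1 ^+ j.
  move=> jm.
  have /M_ratio Mnj : (n + j <= K.+1)%N by rewrite -nm leq_add2l.
  apply: (@le_trans _ _ (b * 2 ^+ (n + j) * (M n * w K ^+ j) * `|h| ^+ j)).
    by rewrite ler_wpM2r ?exprn_ge0// ler_wpM2l// mulr_ge0// exprn_ge0.
  rewrite [leLHS](_ : _ = b * 2 ^+ n * M n * (2 * w K * `|h|) ^+ j).
    rewrite ler_wpM2l//; first by rewrite !mulr_ge0// exprn_ge0.
    rewrite lerXn2r ?nnegrE ?mulr_ge0//; first exact: ltW.
    have w0 := w_gt0 K.
    rewrite (le_trans (ler_wpM2l _ hK)) ?mulr_ge0//; first exact: ltW.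
    by rewrite le_eqVlt; apply/orP; left; apply/eqP; field; exact: lt0r_neq0.
  by rewrite exprD !exprMn; ring.
rewrite -(subrK (\sum_(j < m) G (n + j)%N t * (h ^+ j / j`!%:R)) (G n (t + h))).
apply: (@le_trans _ _
    (\sum_(j < m.+1) b * 2 ^+ (n + j) * M (n + j)%N * `|h| ^+ j)); last first.
  apply: (@le_trans _ _ (\sum_(j < m.+1) b * 2 ^+ n * M n * 2^-1 ^+ j)).
    by apply: ler_sum => j _; rewrite term// -ltnS.
  rewrite -mulr_sumr (le_trans (ler_wpM2l _ (sum_half_powers _ _)))//.
    by rewrite !mulr_ge0// exprn_ge0.
  by rewrite le_eqVlt; apply/orP; left; apply/eqP; ring.
rewrite (le_trans (ler_normD _ _))// big_ord_recr/= [leLHS]addrC lerD//.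
  rewrite (le_trans (ler_norm_sum _ _ _))//; apply: ler_sum => j _.
  by rewrite normrM normf_div normrX (ger0_norm (ler0n _ _)) ler_pM.
rewrite (le_trans (G_taylor _ _ _ _))// mulrC ler_wpM2r ?exprn_ge0//.
by rewrite M_le// nm.
Qed.

Hypothesis G0 : forall n, G n 0 = 0.

(** Downward induction on [k] from [k = N], where [t = 0] and everything vanishes. Passing from
    [K + 1] to [K] is [bang_step] with [b = 2 ^- (K + 1)], the smallest value it admits. *)
Lemma bang_propagation N k t : (k <= N)%N ->
  `|t| <= \sum_(k <= i < N) (4 * w i)^-1 ->
  forall n, `|G n t| <= 2 ^- k * 2 ^+ n * M n.
Proof.
move=> kN; rewrite -(subKn kN); move: (N - k)%N (leq_subr k N) => d.
elim: d t => [|d IH] t dN.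
  rewrite subn0 big_geq// normr_le0 => /eqP -> n.
  by rewrite G0 normr0 !mulr_ge0// ?invr_ge0 exprn_ge0.
set K := (N - d.+1)%N; have KS : (N - d)%N = K.+1 by rewrite /K; lia.
rewrite big_ltn; last by rewrite /K; lia.
set s := (4 * w K)^-1; set S := \sum_(_ <= _ < _) _ => tsS n.
have s0 : 0 < s by rewrite invr_gt0 mulr_gt0.
have S0 : 0 <= S.
  by apply: sumr_ge0 => i _; rewrite invr_ge0 mulr_ge0// ltW.
have sS0 : 0 < s + S by rewrite ltr_wpDr.
(* Splitting [t] in the ratio [S : s] bounds the two parts by [S] and [s], whatever the sign of
   [t]. *)
have -> : t = t * S / (s + S) + t * s / (s + S) by field; exact: lt0r_neq0.
have -> : 2 ^- K = 2 * 2 ^- K.+1 :> R.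
  by rewrite exprS; field; rewrite expf_neq0// pnatr_eq0.
apply: (@bang_step K) => //.
- by rewrite mulVf// expf_neq0.
- move=> n'; rewrite -KS; apply: IH; first exact: ltnW.
  rewrite normf_div normrM (ger0_norm S0) (gtr0_norm sS0) KS.
  by rewrite ler_pdivrMr// mulrC ler_wpM2l.
- rewrite normf_div normrM (gtr0_norm s0) (gtr0_norm sS0) -/s.
  by rewrite ler_pdivrMr// mulrC ler_wpM2l// ltW.
Qed.

Hypothesis w_div : forall A, exists N, A <= \sum_(0 <= i < N) (w i)^-1.

(* Bang's form of the Denjoy-Carleman theorem: the quantity
   [sup_n `|G n t| / (2 ^+ n * M n)] can only grow from [2 ^- k.+1] to [2 ^- k]
   when [t] moves by at least [(4 * w k)^-1], and these steps have infinite
   total length. *)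
Theorem bang t : G 0%N t = 0.
Proof.
have Gk k : `|G 0%N t| <= 2 ^- k * M 0%N.
  (* The first [k] terms are added so that the tail from [k] on exceeds [4 * |t|] by itself; the
     [+ 1] excludes [N <= k]. *)
  have [N] := w_div (4 * `|t| + \sum_(0 <= i < k) (w i)^-1 + 1).
  have [Nk|kN] := leqP N k.
    rewrite [X in _ + X + _](big_cat_nat (leq0n _) Nk)/=.
    have: 0 <= \sum_(N <= i < k) (w i)^-1.
      by apply: sumr_ge0 => i _; rewrite invr_ge0 ltW.
    by have := normr_ge0 t; lra.
  rewrite [X in _ <= X](big_cat_nat (leq0n _) (ltnW kN))/= => tN.
  have := @bang_propagation N k t (ltnW kN).
  rewrite [X in _ <= X](_ : _ = 4^-1 * \sum_(k <= i < N) (w i)^-1); last first.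
    by rewrite mulr_sumr; apply: eq_bigr => i _; rewrite invfM.
  by move=> /(_ _ 0%N); rewrite expr0 mulr1; apply; lra.
apply/eqP; rewrite -normr_le0 leNgt; apply/negP => Gt0.
(* Such a [k] contradicts [Gk k], because [k < 2 ^ k]. *)
pose k := Num.bound (M 0%N / `|G 0%N t|).
have : M 0%N / `|G 0%N t| < k%:R.
  by rewrite /k archi_boundP// divr_ge0.
rewrite ltr_pdivrMr// => /(le_lt_trans _)-/(_ (`|G 0%N t| * 2 ^+ k)).
rewrite mulrC -ler_pdivlMl ?exprn_gt0// => /(_ (Gk k)).
by rewrite ltr_pM2r// -natrX ltr_nat ltnNge ltnW// ltn_expl.
Qed.

End bang.

(** * Taylor's inequality for the cosine *)

Lemma is_derive_taylor_sum (R : realType) (a : nat -> R) m (h : R) :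
  is_derive h 1 (fun x => \sum_(j < m.+1) a j * (x ^+ j / j`!%:R))
    (\sum_(j < m) a j.+1 * (h ^+ j / j`!%:R)).
Proof.
have -> : (fun x => \sum_(j < m.+1) a j * (x ^+ j / j`!%:R)) =
    horner (\poly_(j < m.+1) (a j / j`!%:R)).
  by apply/funext => x; rewrite horner_poly; apply: eq_bigr => j _; ring.
apply: is_derive_eq.
have -> : (\poly_(j < m.+1) (a j / j`!%:R))^`() =
    \poly_(j < m) (a j.+1 / j`!%:R).
  apply/polyP => j; rewrite coef_deriv !coef_poly ltnS; case: ifP => _.
    rewrite factS natrM -mulr_natr; field.
    by rewrite nat1r !pnatr_eq0 -lt0n fact_gt0.
  by rewrite mul0rn.
by rewrite horner_poly; apply: eq_bigr => j _; ring.
Qed.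

(** The [j]-th derivative of the cosine is its shift by [j * pi / 2]. Hence the derivative of the
    remainder of order [m + 1] at [y] is the remainder of order [m] at [y + pi / 2], and the mean
    value theorem gives the induction step. *)
Lemma cos_taylor (R : realType) m (y h : R) :
  `|cos (y + h) -
    \sum_(j < m) cos (y + j%:R * (pi / 2)) * (h ^+ j / j`!%:R)| <= `|h| ^+ m.
Proof.
elim: m y h => [|m IH] y h; first by
  rewrite big_ord0 subr0 expr0 ler_norml cos_geN1 cos_le1.
pose f (x : R) : R := cos (y + x) -
  \sum_(j < m.+1) cos (y + j%:R * (pi / 2)) * (x ^+ j / j`!%:R).
pose df (x : R) : R := cos ((y + pi / 2) + x) -
  \sum_(j < m) cos ((y + pi / 2) + j%:R * (pi / 2)) * (x ^+ j / j`!%:R).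
have fdf (x : R) : is_derive x 1 f (df x).
  apply: is_deriveB.
    apply: is_derive_eq.
    by rewrite [in RHS]addrAC cosDpihalf add0r mulr1.
  apply: is_derive_eq.
    exact: (is_derive_taylor_sum (fun j => cos (y + j%:R * (pi / 2)))).
  apply: eq_bigr => j _; congr (cos _ * _).
  by rewrite -natr1; ring.
have cf : continuous f.
  by move=> x; apply/differentiable_continuous/derivable1_diffP.
have f0 : f 0 = 0.
  rewrite /f big_ord_recl/= big1 => [|j _]; last by rewrite expr0n/= mul0r mulr0.
  by rewrite expr0 fact0 invr1 mul0r !addr0 !mulr1 subrr.
(* Shared by both signs of [h]: the interval [[a, b]] is [[0, h]] or [[h, 0]]. *)
have key a b c : a <= c <= b -> `|c| <= `|h| -> f b - f a = df c * (b - a) ->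
    `|b - a| = `|h| -> `|f b - f a| <= `|h| ^+ m.+1.
  move=> _ ch -> bah; rewrite normrM bah exprSr ler_wpM2r//.
  by rewrite (le_trans (IH _ _))// lerXn2r// nnegrE.
have [h0|h0] := leP 0 h.
  have [//|c] := MVT_segment h0 (fun x _ => fdf x).
    exact: continuous_subspaceT.
  rewrite in_itv/= => /[dup] /andP[c0 ch] c0h /key.
  rewrite f0 !subr0 -/(f h); apply => //.
  by rewrite !ger0_norm.
have [//|c] := MVT_segment (ltW h0) (fun x _ => fdf x).
  exact: continuous_subspaceT.
rewrite in_itv/= => /[dup] /andP[ch c0] c0h /key.
rewrite f0 !sub0r !normrN -/(f h); apply => //.
by rewrite !ler0_norm ?lerN2// ltW.
Qed.

(** * Finite sums under the integral and trigonometric moments *)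

Lemma integrable_RZl d (T : measurableType d) (R : realType)
    (mu : {measure set T -> \bar R}) (D : set T) (r : R) (f : T -> R) :
  measurable D -> mu.-integrable D (EFin \o f) ->
  mu.-integrable D (EFin \o (fun x => r * f x)).
Proof. by move=> mD /(integrableZl mD r); apply: eq_integrable. Qed.

Lemma integrable_Rsum d (T : measurableType d) (R : realType)
    (mu : {measure set T -> \bar R}) (D : set T) m (F : nat -> T -> R) :
  measurable D -> (forall j, mu.-integrable D (EFin \o F j)) ->
  mu.-integrable D (EFin \o (fun x => \sum_(j < m) F j x)).
Proof.
move=> mD iF; rewrite (_ : _ \o _ = (fun x => \sum_(j < m) (F j x)%:E)%E).
  by apply: integrable_sum => // j _; exact: iF.
by apply/funext => x /=; rewrite -sumEFin.
Qed.

Lemma Rintegral_sum d (T : measurableType d) (R : realType)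
    (mu : {measure set T -> \bar R}) (D : set T) m (F : nat -> T -> R) :
  measurable D -> (forall j, mu.-integrable D (EFin \o F j)) ->
  \int[mu]_(x in D) (\sum_(j < m) F j x) = \sum_(j < m) \int[mu]_(x in D) F j x.
Proof.
move=> mD iF; elim: m => [|m IH].
  rewrite big_ord0 (@eq_Rintegral _ _ _ _ _ (cst 0)).
    by rewrite Rintegral_cst// mul0r.
  by move=> x _; rewrite big_ord0.
rewrite big_ord_recr/= -IH -RintegralD//; last exact: integrable_Rsum.
by apply: eq_Rintegral => x _; rewrite big_ord_recr.
Qed.

Section trigonometric_moments.
Context {R : realType} (mu : probability (measurableTypeR R) R).
Hypothesis mu_moments :
  forall k, mu.-integrable [set: R] (EFin \o (fun x : R => x ^+ k)).

Lemma integrable_abs_moment k :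
  mu.-integrable [set: R] (EFin \o (fun x : R => `|x| ^+ k)).
Proof.
have := integrable_norm (mu_moments k).
by apply: eq_integrable => // x _ /=; rewrite normrX.
Qed.

Lemma integrable_expr_cos n (g : R -> R) : measurable_fun setT g ->
  mu.-integrable [set: R] (EFin \o (fun x : R => x ^+ n * cos (g x))).
Proof.
move=> mg; apply: le_integrable (integrable_abs_moment n) => //.
  apply/measurable_EFinP; apply: measurable_funM; first exact: measurable_funX.
  by apply: measurableT_comp mg; apply: continuous_measurable_fun; exact: continuous_cos.
move=> x _ /=; rewrite lee_fin normrM [leRHS]ger0_norm ?exprn_ge0//.
by rewrite normrX ler_piMr ?cos_max// exprn_ge0.
Qed.

(** The [n]-th derivative in [t] of the cosine transform with phase [theta], given directly as an
    integral so that no differentiation under the integral sign is required. *)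
Definition cos_moment (theta : R) n t : R :=
  \int[mu]_x (x ^+ n * cos (t * x + theta + n%:R * (pi / 2))).

Let mphase t theta n : measurable_fun setT
  (fun x : R => t * x + theta + n%:R * (pi / 2)).
Proof. by do 2 apply: measurable_funD => //; exact: measurable_funM. Qed.

Lemma cos_moment_le theta n t :
  `|cos_moment theta n t| <= \int[mu]_x (`|x| ^+ n).
Proof.
have mf := mphase t theta n.
rewrite (le_trans (le_normr_Rintegral _ (integrable_expr_cos _ _)))//.
apply: le_Rintegral => //.
- exact: integrable_norm (integrable_expr_cos _ _).
- exact: integrable_abs_moment.
- by move=> x _; rewrite normrM normrX ler_piMr ?cos_max// exprn_ge0.
Qed.

(** Integrates [cos_taylor] with increment [h * x], multiplied by [x ^ n]. *)
Lemma cos_moment_taylor theta n m t h :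
  `|cos_moment theta n (t + h) -
    \sum_(j < m) cos_moment theta (n + j) t * (h ^+ j / j`!%:R)| <=
  `|h| ^+ m * \int[mu]_x (`|x| ^+ (n + m)).
Proof.
have ic j s := integrable_expr_cos j (mphase s theta j).
pose F j x : R := h ^+ j / j`!%:R *
  (x ^+ (n + j) * cos (t * x + theta + (n + j)%:R * (pi / 2))).
have iF j : mu.-integrable [set: R] (EFin \o F j).
  by apply: integrable_RZl => //; exact: ic.
have -> : \sum_(j < m) cos_moment theta (n + j) t * (h ^+ j / j`!%:R) =
    \int[mu]_x (\sum_(j < m) F j x).
  rewrite Rintegral_sum//; apply: eq_bigr => j _.
  by rewrite mulrC -RintegralZl.
rewrite -RintegralB//; last exact: integrable_Rsum.
have iFm := integrable_Rsum m measurableT iF.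
rewrite -RintegralZl//; last exact: integrable_abs_moment.
rewrite (le_trans (le_normr_Rintegral _ _))//.
  by apply: (integrableB _ (ic n (t + h)) iFm).
apply: le_Rintegral => //.
- by apply: integrable_norm; apply: (integrableB _ (ic n (t + h)) iFm).
- by apply: integrable_RZl => //; exact: integrable_abs_moment.
move=> x _.
have -> : x ^+ n * cos ((t + h) * x + theta + n%:R * (pi / 2)) -
    \sum_(j < m) F j x = x ^+ n *
    (cos (t * x + theta + n%:R * (pi / 2) + h * x) -
     \sum_(j < m) cos (t * x + theta + n%:R * (pi / 2) + j%:R * (pi / 2)) *
       ((h * x) ^+ j / j`!%:R)).
  rewrite mulrBr mulr_sumr; congr (_ * cos _ - _); first by ring.
  apply: eq_bigr => j _; rewrite /F.
  rewrite (_ : _ + (n + j)%:R * (pi / 2) =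
    t * x + theta + n%:R * (pi / 2) + j%:R * (pi / 2)); last by rewrite natrD; ring.
  by rewrite exprD exprMn; ring.
rewrite normrM normrX exprD [leRHS]mulrCA -exprMn -normrM ler_wpM2l ?exprn_ge0//.
exact: cos_taylor.
Qed.

(** The inequality [y <= (c + y ^ 2 / c) / 2] at [y = |x|], multiplied by [|x| ^ (2 k)]. The weight
    [c] stays free, to be matched with the bounds on the even moments. *)
Lemma abs_moment_odd_le k c : 0 < c ->
  \int[mu]_x (`|x| ^+ k.*2.+1) <=
  2^-1 * (c * \int[mu]_x (x ^+ k.*2) + c^-1 * \int[mu]_x (x ^+ k.+1.*2)).
Proof.
move=> c0.
have iZ a k' : mu.-integrable [set: R] (EFin \o (fun x : R => a * x ^+ k')).
  exact: integrable_RZl.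
rewrite -!RintegralZl// -RintegralD// -RintegralZl//; last first.
  exact: (integrableD _ (iZ _ _) (iZ _ _)).
apply: le_Rintegral => //.
- exact: integrable_abs_moment.
- apply: integrable_RZl => //.
  exact: (integrableD _ (iZ _ _) (iZ _ _)).
move=> x _; have even j : x ^+ j.*2 = `|x| ^+ j.*2.
  by rewrite -mul2n !exprM -normrX ger0_norm// sqr_ge0.
rewrite !even; set y := `|x|.
have -> : y ^+ k.+1.*2 = y ^+ k.*2 * y ^+ 2 by rewrite -exprD doubleS addn2.
have cV : c * c^-1 = 1 by rewrite mulfV ?gt_eqF.
have sq : 0 <= c * (1 - y / c) ^+ 2 by rewrite mulr_ge0 ?sqr_ge0// ltW.
have {sq} : y <= 2^-1 * (c + c^-1 * y ^+ 2).
  have -> : c + c^-1 * y ^+ 2 = c * (1 - y / c) ^+ 2 + 2 * y.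
    by field; rewrite gt_eqF.
  by lra.
have Y0 : 0 <= y ^+ k.*2 by rewrite exprn_ge0// normr_ge0.
move=> /(ler_wpM2l Y0); rewrite -exprSr => /le_trans; apply.
by rewrite le_eqVlt; apply/orP; left; apply/eqP; ring.
Qed.

End trigonometric_moments.

(** * Uniqueness of cosine transforms by quasi-analyticity *)

Section quasi_analyticity.
Context {R : realType} (C : R) (z : nat -> R).
Hypothesis C_ge0 : 0 <= C.
Hypothesis z_gt0 : forall k, 0 < z k.
Hypothesis z_nd : {homo z : m n / (m <= n)%N >-> m <= n}.
Hypothesis z_div : forall A, exists N, A <= \sum_(0 <= i < N) (z i)^-1.

(** Each [z i] enters twice, so [W (2 k)] is the bound on the even moments, while the successive
    ratios [z (n / 2)] remain non-decreasing, as [bang] demands. *)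
Let W n : R := \prod_(i < n) z i./2.

Let W_even k : W k.*2 = \prod_(i < k) z i ^+ 2.
Proof.
elim: k => [|k IH]; first by rewrite /W !big_ord0.
rewrite doubleS /W !big_ord_recr/= -/(W _) IH uphalf_double doubleK.
by rewrite -mulrA expr2.
Qed.

Lemma abs_moment_le (mu : probability (measurableTypeR R) R) :
  (forall k, mu.-integrable [set: R] (EFin \o (fun x : R => x ^+ k))) ->
  (forall k, \int[mu]_x (x ^+ k.*2) <= C * \prod_(i < k) z i ^+ 2) ->
  forall n, \int[mu]_x (`|x| ^+ n) <= C * W n.
Proof.
move=> imu mu_le n; rewrite -(odd_double_half n).
case: (odd n); rewrite ?add0n ?add1n; last first.
  rewrite W_even (le_trans _ (mu_le _))//.
  rewrite le_eqVlt; apply/orP; left; apply/eqP; apply: eq_Rintegral => x _.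
  by rewrite -mul2n !exprM -normrX ger0_norm// sqr_ge0.
set k := n./2.
have z0 := z_gt0 k.
(* With weight [z k] both summands are at most [C * z k * W (2 k)], which is [C * W (2 k + 1)]. *)
rewrite (le_trans (abs_moment_odd_le imu k z0))//.
apply: (@le_trans _ _ (2^-1 * (z k * (C * W k.*2) + (z k)^-1 * (C * W k.+1.*2)))).
  rewrite ler_wpM2l// lerD// ler_wpM2l ?W_even// ?invr_ge0; exact: ltW.
rewrite doubleS /W !big_ord_recr/= uphalf_double doubleK -/(W _).
by rewrite le_eqVlt; apply/orP; left; apply/eqP; field; rewrite gt_eqF.
Qed.

(** [bang] is applied to the differences of the trigonometric moments of [mu] and [nu]. At [t = 0]
    these are [cos (theta + n * pi / 2)] times the difference of the [n]-th moments. Only this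
    product has to vanish, so for [theta = 0] the odd moments may differ. *)
Theorem cos_transform_unique (mu nu : probability (measurableTypeR R) R)
    (theta : R) :
  (forall k, mu.-integrable [set: R] (EFin \o (fun x : R => x ^+ k))) ->
  (forall k, nu.-integrable [set: R] (EFin \o (fun x : R => x ^+ k))) ->
  (forall k, \int[mu]_x (x ^+ k.*2) <= C * \prod_(i < k) z i ^+ 2) ->
  (forall k, \int[nu]_x (x ^+ k.*2) <= C * \prod_(i < k) z i ^+ 2) ->
  (forall n, cos (theta + n%:R * (pi / 2)) *
    (\int[mu]_x (x ^+ n) - \int[nu]_x (x ^+ n)) = 0) ->
  forall t, \int[mu]_x (cos (t * x + theta)) = \int[nu]_x (cos (t * x + theta)).
Proof.
move=> imu inu mu_le nu_le moments t.
have mu_abs := abs_moment_le imu mu_le; have nu_abs := abs_moment_le inu nu_le.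
pose G n s := cos_moment mu theta n s - cos_moment nu theta n s.
have cos_moment0 (m : probability (measurableTypeR R) R) :
    (forall k, m.-integrable [set: R] (EFin \o (fun x : R => x ^+ k))) ->
    forall n, cos_moment m theta n 0 =
    cos (theta + n%:R * (pi / 2)) * \int[m]_x (x ^+ n).
  move=> im n; rewrite -RintegralZl//; apply: eq_Rintegral => x _.
  by rewrite mul0r add0r mulrC.
suff : G 0%N t = 0.
  move/subr0_eq; rewrite /cos_moment.
  under [LHS]eq_Rintegral do rewrite expr0 mul1r mul0r addr0.
  by under [RHS]eq_Rintegral do rewrite expr0 mul1r mul0r addr0.
apply: (@bang _ (fun n => z n./2) (fun n => 2 * C * W n)).
- by move=> n.
- by move=> m n mn; apply: z_nd; exact: half_leq.
- by rewrite mulr_ge0 ?mulr_ge0// /W big_ord0.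
- by move=> n; rewrite /W big_ord_recr/= mulrA.
- move=> n s; rewrite (le_trans (ler_normB _ _))//.
  have := cos_moment_le imu theta n s; have := cos_moment_le inu theta n s.
  by have := mu_abs n; have := nu_abs n; lra.
- move=> n m s h; rewrite /G.
  have -> : cos_moment mu theta n (s + h) - cos_moment nu theta n (s + h) -
      \sum_(j < m) (cos_moment mu theta (n + j) s -
        cos_moment nu theta (n + j) s) * (h ^+ j / j`!%:R) =
    (cos_moment mu theta n (s + h) -
      \sum_(j < m) cos_moment mu theta (n + j) s * (h ^+ j / j`!%:R)) -
    (cos_moment nu theta n (s + h) -
      \sum_(j < m) cos_moment nu theta (n + j) s * (h ^+ j / j`!%:R)).
    rewrite (eq_bigr (fun j : 'I_m =>
      cos_moment mu theta (n + j) s * (h ^+ j / j`!%:R) -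
      cos_moment nu theta (n + j) s * (h ^+ j / j`!%:R))); last first.
      by move=> j _; rewrite mulrBl.
    by rewrite sumrB; ring.
  rewrite (le_trans (ler_normB _ _))//.
  rewrite (_ : _ * (2 * C * _) = `|h| ^+ m * (C * W (n + m)%N) +
    `|h| ^+ m * (C * W (n + m)%N)); last by ring.
  apply: lerD.
    by rewrite (le_trans (cos_moment_taylor imu _ _ _ _ _))// ler_wpM2l ?exprn_ge0.
  by rewrite (le_trans (cos_moment_taylor inu _ _ _ _ _))// ler_wpM2l ?exprn_ge0.
- by move=> n; rewrite /G !cos_moment0// -mulrBr.
(* Each of [z 0, ..., z (N - 1)] occurs twice among the first [2 N] ratios. *)
move=> A; have [N AN] := z_div A; exists N.*2; apply: (le_trans AN).
elim: N {AN} => [|N IH]; first by rewrite !big_geq.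
rewrite doubleS !big_nat_recr//= uphalf_double doubleK -addrA lerD// lerDl.
by rewrite invr_ge0 ltW.
Qed.

End quasi_analyticity.

(** * The sign function as a limit of polynomials *)

Section sign_iteration.
Context {R : realType}.

Definition sgn_step (u : R) : R := (3 * u - u ^+ 3) / 2.

(** One step multiplies the distance to 1 of an iterate [v] by [1 - v * (1 + v) / 2]. This is at
    most [1 - u / 2], since the iterates never fall below their start [u]. *)
Lemma sgn_iter_ge u n : 0 <= u <= 1 ->
  [/\ u <= iter n sgn_step u, iter n sgn_step u <= 1 &
      1 - iter n sgn_step u <= (1 - u / 2) ^+ n].
Proof.
move=> /andP[u0 u1]; elim: n => [|n [uv v1 vn]].
  by split=> //=; rewrite expr0 gerBl.
rewrite iterS; move: (iter n sgn_step u) uv v1 vn => v uv v1 vn.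
have v0 : 0 <= v by exact: le_trans uv.
have -> : sgn_step v = 1 - (1 - v) * (1 - v / 2 * (1 + v)).
  by rewrite /sgn_step; field.
have vv : v / 2 * (1 + v) <= 1.
  by nra.
split.
- by nra.
- by rewrite gerBl mulr_ge0// subr_ge0.
- rewrite opprB addrC subrK exprSr ler_pM ?subr_ge0//.
  by nra.
Qed.

Lemma cvg_sgn_iter u : -1 <= u <= 1 ->
  iter n sgn_step u @[n --> \oo] --> (Num.sg u : R).
Proof.
have pos (v : R) : 0 < v <= 1 -> iter n sgn_step v @[n --> \oo] --> (1 : R).
  move=> /andP[v0 v1].
  have h n := @sgn_iter_ge v n (introT andP (conj (ltW v0) v1)).
  have g0 : (1 - v / 2) ^+ n @[n --> \oo] --> (0 : R).
    by apply: cvg_expr; rewrite ger0_norm; lra.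
  have g1 : 1 - (1 - v / 2) ^+ n @[n --> \oo] --> (1 : R).
    by rewrite -[X in _ --> X]subr0; apply: cvgB => //; exact: cvg_cst.
  apply: (@squeeze_cvgr _ _ _ _ (fun n => 1 - (1 - v / 2) ^+ n) (cst 1)) => //;
    last exact: cvg_cst.
  by near=> n; have [_ -> le] := h n; rewrite andbT lerBlDr -lerBlDl.
have opp n (v : R) : iter n sgn_step (- v) = - iter n sgn_step v.
  by elim: n => //= n ->; rewrite /sgn_step; ring.
move=> /andP[u1 u2]; have [u0|u0|->] := ltgtP u 0.
- rewrite ltr0_sg// -[u]opprK.
  under eq_fun do rewrite opp.
  by apply: cvgN; apply: pos; rewrite oppr_gt0 u0 lerNl.
- by rewrite gtr0_sg//; apply: pos; rewrite u0.
- rewrite sgr0; have -> : (fun n => iter n sgn_step 0) = cst 0; last exact: cvg_cst.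
  by apply/funext; elim=> //= n ->; rewrite /sgn_step; ring.
Unshelve. all: by end_near. Qed.

End sign_iteration.

(** * Functions with equal integrals under two probability measures *)

Section agreement.
Context {R : realType} (mu nu : probability (measurableTypeR R) R).

(** Measurability and boundedness are included so that the class is closed under linear combinations
    and uniformly bounded pointwise limits. *)
Definition agree (f : R -> R) :=
  [/\ measurable_fun [set: R] f, exists K : R, forall x, `|f x| <= K &
      \int[mu]_x f x = \int[nu]_x f x].

Lemma bounded_prob_integrable (m : probability (measurableTypeR R) R)
    (f : R -> R) (K : R) :
  measurable_fun [set: R] f -> (forall x, `|f x| <= K) ->
  m.-integrable [set: R] (EFin \o f).
Proof.
move=> mf fK; apply: le_integrable (finite_measure_integrable_cst m K measurableT) => //.
  exact/measurable_EFinP.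
by move=> x _ /=; rewrite lee_fin (le_trans (fK _))// ler_norm.
Qed.

Lemma agree_lin c f g : agree f -> agree g -> agree (fun x => c * f x + g x).
Proof.
move=> [mf [K fK] fE] [mg [L gL] gE]; split.
- by apply: measurable_funD => //; exact: measurable_funM.
- exists (`|c| * K + L) => x; rewrite (le_trans (ler_normD _ _))// lerD//.
  by rewrite normrM ler_wpM2l.
- have int (m : probability (measurableTypeR R) R) :
      m.-integrable [set: R] (EFin \o f) := bounded_prob_integrable m mf fK.
  have int' (m : probability (measurableTypeR R) R) :
      m.-integrable [set: R] (EFin \o g) := bounded_prob_integrable m mg gL.
  have split (m : probability (measurableTypeR R) R) :
      \int[m]_x (c * f x + g x) = c * \int[m]_x f x + \int[m]_x g x.
    rewrite (RintegralD measurableT (integrable_RZl c measurableT (int m))) //.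
      by rewrite RintegralZl//; exact: int.
    exact: int'.
  by rewrite !split fE gE.
Qed.

Lemma agree_cvg (F : nat -> R -> R) (f : R -> R) (K : R) :
  (forall n, agree (F n)) -> (forall n x, `|F n x| <= K) ->
  (forall x, F n x @[n --> \oo] --> f x) -> agree f.
Proof.
move=> aF FK Ff.
have mF n : measurable_fun [set: R] (F n) by have [] := aF n.
have mf : measurable_fun [set: R] f.
  by apply: (measurable_fun_cvg (h := F)) => // x _; exact: Ff.
have fK x : `|f x| <= K.
  have h : `|F n x| @[n --> \oo] --> `|f x| by exact: cvg_norm (Ff x).
  rewrite -(cvg_lim _ h)//.
  by apply: limr_le; [exact: cvgP h|exact: nearW].
have lim (m : probability (measurableTypeR R) R) :
    (\int[m]_x (F n x)%:E)%E @[n --> \oo] --> (\int[m]_x (f x)%:E)%E.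
  have [] := @dominated_convergence _ _ _ m setT measurableT
    (fun n x => (F n x)%:E) (EFin \o f) (cst K%:E) => //.
  - by move=> n; apply/measurable_EFinP; exact: mF.
  - exact/measurable_EFinP.
  - by apply: aeW => x _; apply: cvg_EFin; [exact: nearW|exact: Ff].
  - exact: finite_measure_integrable_cst.
  - by apply: aeW => x n _ /=; rewrite lee_fin.
split=> //; first by exists K.
congr fine; apply: (cvg_unique _ (lim mu)) => //.
rewrite (_ : (fun n => _) = (fun n => \int[nu]_x (F n x)%:E)%E); first exact: lim.
apply/funext => n; have [_ _ ] := aF n; rewrite /Rintegral.
have fin (m : probability (measurableTypeR R) R) :
    (\int[m]_x (F n x)%:E)%E \is a fin_num.
  exact: integrable_fin_num (bounded_prob_integrable m (mF n) (FK n)).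
by move=> FE; rewrite -(fineK (fin mu)) -(fineK (fin nu)) FE.
Qed.

End agreement.

Inductive linear_span (R : realType) (A : set (R -> R)) : set (R -> R) :=
| span_base f : A f -> linear_span A f
| span_lin c f g : linear_span A f -> linear_span A g ->
    linear_span A (fun x => c * f x + g x).

Section span_algebra.
Context {R : realType} (A : set (R -> R)).
Hypothesis A_neq0 : A !=set0.
Hypothesis A_mul : forall f g, A f -> A g ->
  exists u v, [/\ A u, A v & forall x, f x * g x = 2^-1 * (u x + v x)].

Let span0 : linear_span A (fun=> 0).
Proof.
have [f Af] := A_neq0; rewrite (_ : (fun=> 0) = (fun x => -1 * f x + f x)).
  by apply: span_lin; exact: span_base.
by apply/funext => x; rewrite mulN1r addNr.
Qed.

Let span_scale c f : linear_span A f -> linear_span A (fun x => c * f x).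
Proof.
move=> Af; rewrite (_ : (fun x => c * f x) = (fun x => c * f x + 0)).
  exact: span_lin.
by apply/funext => x; rewrite addr0.
Qed.

(** A product of two generators is half the sum of two generators; bilinearity extends this to the
    span, which is therefore closed under polynomials without constant term such as [sgn_step]. *)
Lemma span_mul f g :
  linear_span A f -> linear_span A g -> linear_span A (fun x => f x * g x).
Proof.
move=> sf sg; elim: sf => [{}f Af|c f1 f2 _ IH1 _ IH2]; last first.
  rewrite (_ : (fun x => _) = (fun x => c * (f1 x * g x) + f2 x * g x)).
    exact: span_lin.
  by apply/funext => x; rewrite mulrDl mulrA.
elim: sg => [{}g Ag|c g1 g2 _ IH1 _ IH2].
  have [u [v [Au Av fg]]] := A_mul Af Ag.
  rewrite (_ : (fun x => _) = (fun x => 2^-1 * u x + 2^-1 * v x)).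
    by apply: span_lin; [exact: span_base|exact/span_scale/span_base].
  by apply/funext => x; rewrite fg mulrDr.
rewrite (_ : (fun x => _) = (fun x => c * (f x * g1 x) + f x * g2 x)).
  exact: span_lin.
by apply/funext => x; rewrite mulrDr mulrCA.
Qed.

Lemma span_sgn_iter u n :
  linear_span A u -> linear_span A (fun x => iter n sgn_step (u x)).
Proof.
move=> Au; elim: n => [//|n IH].
set v := (fun x => iter n sgn_step (u x)) in IH.
rewrite (_ : (fun x => _) = (fun x => 3 / 2 * v x + - 2^-1 * (v x * (v x * v x)))).
  by apply: span_lin => //; apply: span_scale; do 2 apply: span_mul => //.
by apply/funext => x; rewrite iterS /sgn_step -/(v x); field.
Qed.

Context (mu nu : probability (measurableTypeR R) R).
Hypothesis A_agree : forall f, A f -> agree mu nu f.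

Lemma span_agree f : linear_span A f -> agree mu nu f.
Proof.
by elim=> [g Ag|c g h _ IHg _ IHh]; [exact: A_agree|exact: agree_lin].
Qed.

Lemma span_agree_sg u : linear_span A u -> (forall x, -1 <= u x <= 1) ->
  agree mu nu (fun x => Num.sg (u x)).
Proof.
move=> Au u1; apply: (@agree_cvg _ _ _ (fun n x => iter n sgn_step (u x)) _ 1).
- by move=> n; exact/span_agree/span_sgn_iter.
- move=> n x; elim: n => [|n]; first by rewrite ler_norml u1.
  rewrite iterS !ler_norml; move: (iter n _ _) => v /andP[v1 v2].
  (* These products are twice [1 + sgn_step v] and twice [1 - sgn_step v], so [[-1, 1]] is
     stable. *)
  have lo : 0 <= (1 + v) ^+ 2 * (2 - v) by rewrite mulr_ge0 ?sqr_ge0//; lra.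
  have hi : 0 <= (1 - v) ^+ 2 * (2 + v) by rewrite mulr_ge0 ?sqr_ge0//; lra.
  by rewrite /sgn_step; apply/andP; split; lra.
- by move=> x; exact: cvg_sgn_iter.
Qed.

End span_algebra.

(** * From cosine transforms to distribution functions *)

Section cosines.
Context {R : realType}.

(** The set of phases is a parameter: all reals for laws on the line, [[set 0]] when only even
    moments are known. Either choice is closed under sums and differences, hence compatible with the
    product formula. *)
Definition cosines (Theta : set R) : set (R -> R) :=
  [set f | exists t theta, Theta theta /\ f = (fun x => cos (t * x + theta))].

Lemma cosines_mul (Theta : set R) :
  (forall a b, Theta a -> Theta b -> Theta (a + b) /\ Theta (a - b)) ->
  forall f g, cosines Theta f -> cosines Theta g ->
  exists u v, [/\ cosines Theta u, cosines Theta v &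
    forall x, f x * g x = 2^-1 * (u x + v x)].
Proof.
move=> TD f g [t [a [Ta ->]]] [s [b [Tb ->]]]; have [Tab Tba] := TD _ _ Ta Tb.
exists (fun x => cos ((t + s) * x + (a + b))).
exists (fun x => cos ((t - s) * x + (a - b))); split.
- by exists (t + s), (a + b).
- by exists (t - s), (a - b).
move=> x.
have -> : (t + s) * x + (a + b) = (t * x + a) + (s * x + b) by ring.
have -> : (t - s) * x + (a - b) = (t * x + a) - (s * x + b) by ring.
by move: (t * x + a) (s * x + b) => p q; rewrite cosD cosB; field.
Qed.

Lemma sg_sin (y : R) : `|y| < 1 -> Num.sg (sin y) = Num.sg y.
Proof.
have pos (v : R) : 0 < v < 1 -> Num.sg (sin v) = 1.
  move=> /andP[v0 v1]; rewrite gtr0_sg// sin_gt0_pihalf// v0/=.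
  by rewrite (lt_le_trans v1)// pihalf_ge1.
rewrite ltr_norml => /andP[y1 y2]; have [y0|y0|->] := ltgtP y 0.
- rewrite (ltr0_sg y0) -[y]opprK sinN sgrN pos//.
  by rewrite oppr_gt0 y0 ltrNl.
- by rewrite pos ?y0// gtr0_sg.
- by rewrite sin0.
Qed.

Lemma sg_cosB (p q : R) : 0 <= p <= 1 -> 0 <= q <= 1 ->
  Num.sg (2^-1 * cos p - 2^-1 * cos q) = Num.sg (q - p).
Proof.
move=> /andP[p0 p1] /andP[q0 q1].
have pi1 : (1 : R) <= pi by have := @pihalf_ge1 R; lra.
have pI : p \in `[0, pi] by rewrite in_itv/= p0 (le_trans p1).
have qI : q \in `[0, pi] by rewrite in_itv/= q0 (le_trans q1).
rewrite -mulrBr sgrM gtr0_sg ?invr_gt0// mul1r.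
have [pq|qp|->] := ltgtP p q; last by rewrite !subrr.
  by rewrite !gtr0_sg// subr_gt0 ?ltr_cos.
by rewrite !ltr0_sg// subr_lt0 ?ltr_cos.
Qed.

Context (mu nu : probability (measurableTypeR R) R).

(** The indicator of [h <= a] is the limit of [(1 + sg (a + 1 / (n + 1) - h)) / 2]. Approaching [a]
    from above makes points with [h x = a] count as 1 rather than 1/2. *)
Lemma sublevel_agree (h : R -> R) a : measurable_fun [set: R] h ->
  (forall b, a < b -> agree mu nu (fun x => Num.sg (b - h x))) ->
  mu [set x | h x <= a] = nu [set x | h x <= a].
Proof.
move=> mh ah; set S := [set x | h x <= a].
have mS : measurable S.
  rewrite (_ : S = setT `&` h @^-1` `]-oo, a]%classic).
    by apply: mh => //; exact: measurable_itv.
  by rewrite setTI /S; apply/seteqP; split => x /=; rewrite in_itv.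
have agree_cst c : agree mu nu (cst c).
  split => //; first by exists `|c|.
  rewrite !Rintegral_cst//; congr (_ * fine _).
  exact: etrans (probability_setT mu) (esym (probability_setT nu)).
have : agree mu nu (\1_S : R -> R).
  rewrite (_ : (\1_S : R -> R) = (fun x => 2^-1 * (2 * \1_S x - 1) + cst 2^-1 x)).
    apply: agree_lin => //.
    apply: (@agree_cvg _ _ _ (fun n x => Num.sg (a + n.+1%:R^-1 - h x)) _ 1).
    - by move=> n; apply: ah; rewrite ltrDl.
    - by move=> n x; rewrite normr_sg lern1 leq_b1.
    move=> x; apply: cvg_near_cst; rewrite indicE.
    have [xS|xS] := boolP (x \in S).
      apply: nearW => n; rewrite gtr0_sg/=; first by ring.
      by move: xS; rewrite inE /S/= subr_gt0 => /le_lt_trans; apply; rewrite ltrDl.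
    move: xS; rewrite notin_setE/= /S/= => /negP; rewrite -ltNge -subr_gt0 => xS.
    near=> n; rewrite ltr0_sg/=; first by ring.
    rewrite subr_lt0 -ltrBrDl; near: n.
    exact: near_infty_natSinv_lt (PosNum xS).
  by apply/funext => x /=; field.
move=> [_ _]; rewrite /Rintegral !integral_indic// !setIT => muS.
by rewrite -(fineK (fin_num_measure mu _ mS)) -(fineK (fin_num_measure nu _ mS)) muS.
Unshelve. all: by end_near. Qed.

Let cos_agree t theta :
  \int[mu]_x (cos (t * x + theta)) = \int[nu]_x (cos (t * x + theta)) ->
  agree mu nu (fun x => cos (t * x + theta)).
Proof.
move=> E; split => //; last by exists 1 => x; exact: cos_max.
apply: measurableT_comp.
  by apply: continuous_measurable_fun; exact: continuous_cos.
by apply: measurable_funD => //; exact: measurable_funM.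
Qed.

(** The sign of [b - x] equals that of [sin ((b - x) / (n + 1))] once [n] is large, and this sine is
    a cosine with a phase. *)
Lemma cos_transform_cdf a :
  (forall t theta,
    \int[mu]_x (cos (t * x + theta)) = \int[nu]_x (cos (t * x + theta))) ->
  mu [set x | x <= a] = nu [set x | x <= a].
Proof.
move=> E; apply: (@sublevel_agree id) => // b _.
pose u n x : R := cos (n.+1%:R^-1 * x + (- (n.+1%:R^-1 * b) + pi / 2)).
have uE n x : u n x = sin (n.+1%:R^-1 * (b - x)).
  by rewrite /u addrA cosDpihalf -sinN; congr sin; ring.
apply: (@agree_cvg _ _ _ (fun n x => Num.sg (u n x)) _ 1).
- move=> n; apply: (@span_agree_sg _ (cosines setT)).
  + by exists (fun x => cos (0 * x + 0)), 0, 0.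
  + exact: cosines_mul.
  + by move=> f [t [theta [_ ->]]]; exact: cos_agree.
  + by apply: span_base; exists n.+1%:R^-1, (- (n.+1%:R^-1 * b) + pi / 2).
  + by move=> x; rewrite cos_geN1 cos_le1.
- by move=> n x; rewrite normr_sg lern1 leq_b1.
move=> x; apply: cvg_near_cst; near=> n; rewrite uE sg_sin ?sgrM.
  by rewrite gtr0_sg ?invr_gt0// mul1r.
rewrite normrM ger0_norm// ltr_pdivrMl// mulr1.
rewrite (@lt_trans _ _ n%:R) ?ltr_nat//.
near: n; exact: nbhs_infty_gtr.
Unshelve. all: by end_near. Qed.

(** Without phases, the sign of [b - |x|] comes from [cos (x / (n + 1)) - cos (b / (n + 1))] for
    large [n], the cosine being even and decreasing on [[0, 1]]. *)
Lemma cos_transform_norm_cdf a : 0 <= a ->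
  (forall t, \int[mu]_x (cos (t * x)) = \int[nu]_x (cos (t * x))) ->
  mu [set x | `|x| <= a] = nu [set x | `|x| <= a].
Proof.
move=> a0 E; apply: (@sublevel_agree Num.norm) => // b ab.
have b0 : 0 <= b by rewrite (le_trans a0)// ltW.
(* The halves keep the values in [[-1, 1]], as [span_agree_sg] requires. *)
pose u n x : R := 2^-1 * cos (n.+1%:R^-1 * x) - 2^-1 * cos (n.+1%:R^-1 * b).
have uE n x : u n x =
  2^-1 * cos (n.+1%:R^-1 * `|x|) - 2^-1 * cos (n.+1%:R^-1 * b).
  rewrite /u -[cos (_ * x)]cos_norm normrM [`|n.+1%:R^-1|]ger0_norm//.
have one : cosines [set 0] (fun x => cos (0 * x + 0)) by exists 0, 0.
apply: (@agree_cvg _ _ _ (fun n x => Num.sg (u n x)) _ 1).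
- move=> n; apply: (@span_agree_sg _ (cosines [set 0])).
  + by exists (fun x => cos (0 * x + 0)).
  + apply: cosines_mul => _ _ -> ->; by rewrite addr0 subr0.
  + move=> f [t [theta [-> ->]]]; apply: cos_agree.
    under eq_Rintegral do rewrite addr0.
    by under [RHS]eq_Rintegral do rewrite addr0.
  + pose c := - (2^-1 * cos (n.+1%:R^-1 * b)).
    (* The constant [c] must lie in the span: [o] is the constant 1, and [- 1 * o + o] is a zero
       that ends the combination with a generator. *)
    pose o x : R := cos (0 * x + 0).
    rewrite (_ : u n = (fun x => 2^-1 * cos (n.+1%:R^-1 * x + 0) +
        (c * o x + (- 1 * o x + o x)))).
      apply: span_lin; first by apply: span_base; exists n.+1%:R^-1, 0.
      by do 2! [apply: span_lin; first exact: span_base]; exact: span_base.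
    apply/funext => x; rewrite /u /o /c mul0r !addr0 cos0; ring.
  + move=> x; rewrite /u; have := cos_geN1 (n.+1%:R^-1 * x).
    have := cos_le1 (n.+1%:R^-1 * x); have := cos_geN1 (n.+1%:R^-1 * b).
    by have := cos_le1 (n.+1%:R^-1 * b) => *; apply/andP; split; lra.
- by move=> n x; rewrite normr_sg lern1 leq_b1.
move=> x; apply: cvg_near_cst; near=> n; rewrite uE sg_cosB.
- by rewrite -mulrBr sgrM gtr0_sg ?invr_gt0// mul1r.
- rewrite mulr_ge0//= ler_pdivrMl// mulr1 (@le_trans _ _ n%:R) ?ler_nat//.
  near: n; exact: nbhs_infty_ger.
- rewrite mulr_ge0//= ler_pdivrMl// mulr1 (@le_trans _ _ n%:R) ?ler_nat//.
  near: n; exact: nbhs_infty_ger.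
Unshelve. all: by end_near. Qed.

Lemma cdf_unique : (forall a, mu [set x | x <= a] = nu [set x | x <= a]) ->
  forall A : set R, measurable A -> mu A = nu A.
Proof.
move=> E A mA.
apply: (@measure_unique _ R (measurableTypeR R) (@RGenOInfty.G R)
  (fun n => `]- n%:R, +oo[%classic) _ _ _ _ mu nu _ _ A mA).
- exact: RGenOInfty.measurableE.
- move=> _ _ [x ->] [y ->]; exists (Num.max x y).
  by apply/seteqP; split => z /=; rewrite !in_itv/= !andbT gt_max => /andP.
- by move=> i; exists (- i%:R).
- rewrite -subTset => x _; exists (Num.bound `|x|) => //=.
  rewrite in_itv/= andbT ltrNl (le_lt_trans (ler_norm _))// normrN.
  exact: archi_boundP.
- move=> _ [x ->].
  have -> : `]x, +oo[%classic = ~` [set y : R | y <= x].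
    by apply/seteqP; split => y /=; rewrite in_itv/= andbT ltNge => /negP.
  have mx : measurable [set y : R | y <= x] by rewrite -set_itvNyc.
  have mC := probability_setC mu mx; have nC := probability_setC nu mx.
  by rewrite E -nC in mC; exact: mC.
- by move=> k; rewrite (le_lt_trans (probability_le1 _ _)) ?ltry//; exact: measurable_itv.
Qed.

End cosines.

(** * Laws of random variables and transfer of moments *)

Section law.
Context d (T : measurableType d) (R : realType) (P : probability T R).
Context (X : T -> R) (mX : measurable_fun [set: T] X).

Let X_mfun : @measurable_fun _ _ T (measurableTypeR R) [set: T] X.
Proof. by move=> _ A mA; exact: (mX _ mA). Qed.

(* The law as a measure on [measurableTypeR R], the type over which the
   competing distributions range; [distribution P X] is a measure on [R], whose
   measurable structure carries another display. *)
Definition law : probability (measurableTypeR R) R :=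
  distribution P (@mfun_Sub _ _ T (measurableTypeR R) X (mem_set X_mfun)).

Lemma lawE A : law A = P (X @^-1` A). Proof. by []. Qed.

Lemma integrable_law (g : R -> R) :
  measurable_fun setT g -> P.-integrable setT (EFin \o (g \o X)) ->
  law.-integrable setT (EFin \o g).
Proof.
by move=> mg ig; apply: integrable_pushforward => //; exact/measurable_EFinP.
Qed.

Lemma Rintegral_law (g : R -> R) :
  measurable_fun setT g -> P.-integrable setT (EFin \o (g \o X)) ->
  \int[law]_x g x = \int[P]_w g (X w).
Proof.
move=> mg ig; rewrite /Rintegral /law integral_distribution//.
exact/measurable_EFinP.
Qed.

Lemma finite_moments_integrable : finite_moments P X ->
  forall k, P.-integrable setT (EFin \o (fun w => X w ^+ k)).
Proof.
move=> + k => /(_ k); rewrite unlock => Xk; apply/integrableP; split.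
  by apply/measurable_EFinP; exact: measurable_funX.
by under eq_integral do rewrite /= normrX.
Qed.

End law.

Lemma same_moments_Rintegral d (T : measurableType d) d' (T' : measurableType d')
    (R : realType) (P : probability T R) (Q : probability T' R)
    (X : T -> R) (Y : T' -> R) :
  same_moments P X Q Y ->
  forall k, \int[P]_w (X w ^+ k) = \int[Q]_w (Y w ^+ k).
Proof. by move=> + k => /(_ k); rewrite unlock /Rintegral => ->. Qed.

Lemma cos_odd_halfpi (R : realType) n : odd n -> cos (n%:R * (pi / 2)) = 0 :> R.
Proof.
move=> on; rewrite -(odd_double_half n) on; elim: (n./2) => [|k IH].
  by rewrite mul1r cos_pihalf.
rewrite doubleS (_ : _ * _ = (true + k.*2)%:R * (pi / 2) + pi).
  by rewrite cosDpi IH oppr0.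
by rewrite !natrD -addn2 natrD; field.
Qed.

(** * Determinacy and Carleman's condition from a bound on even moments *)

Section determinacy.
Context {R : realType} (C : R) (z : nat -> R).
Hypothesis C_ge0 : 0 <= C.
Hypothesis z_gt0 : forall k, 0 < z k.
Hypothesis z_nd : {homo z : m n / (m <= n)%N >-> m <= n}.
Hypothesis z_div : forall A, exists N, A <= \sum_(0 <= i < N) (z i)^-1.
Context d (T : measurableType d) (P : probability T R) (X : {RV P >-> R}).
Hypothesis X_moments : finite_moments P X.
Hypothesis X_even :
  forall k, \int[P]_w (X w ^+ k.*2) <= C * \prod_(i < k) z i ^+ 2.

Let mu := law P (measurable_funPT X).

Let iX k : P.-integrable setT (EFin \o (fun w => X w ^+ k)).
Proof. exact: finite_moments_integrable. Qed.

Let imu k : mu.-integrable setT (EFin \o (fun x : R => x ^+ k)).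
Proof. apply: (integrable_law (measurable_funPT X) (g := fun x => x ^+ k)).
  exact: measurable_funX.
exact: iX.
Qed.

Let muE k : \int[mu]_x (x ^+ k) = \int[P]_w (X w ^+ k).
Proof.
rewrite (Rintegral_law (measurable_funPT X) (g := fun x => x ^+ k))//.
exact: iX.
Qed.

Lemma M_determinate_of_moment_bound : M_determinate P X.
Proof.
split => // Q Qfin Qmom A mA.
have iQ : forall k, Q.-integrable setT (EFin \o (fun x : R => x ^+ k)).
  exact: finite_moments_integrable.
have QE k : \int[Q]_x (x ^+ k) = \int[mu]_x (x ^+ k).
  by rewrite muE; exact: same_moments_Rintegral.
apply: (@cdf_unique _ Q mu) => // a; apply: cos_transform_cdf => t theta.
apply: (cos_transform_unique C_ge0 z_gt0 z_nd z_div) => //.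
- by move=> k; rewrite QE muE.
- by move=> k; rewrite muE.
- by move=> n; rewrite QE subrr mulr0.
Qed.

(** The law [nu] of the square root under a competitor [Q] has the even moments of [X]. At phase 0
    the odd ones carry the coefficient 0, so [nu] and the law of [X] give equal mass to each
    [|x| <= sqrt a], that is, [Q] and the law of [X ^ 2] to each [x <= a]. *)
Lemma M_determinate_nneg_sqr_of_moment_bound :
  M_determinate_nneg P ((X : {mfun T >-> R}) ^+ 2).
Proof.
split.
- by move=> w /=; rewrite sqr_ge0.
- move=> k; have := X_moments (2 * k); rewrite !unlock.
  by under eq_integral do rewrite exprM -normrX.
move=> Q Q1 Qfin Qmom A mA.
have msqrt : @measurable_fun _ _ (measurableTypeR R) R setT Num.sqrt.
  by apply: continuous_measurable_fun; exact: sqrt_continuous.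
have iQ : forall k, Q.-integrable setT (EFin \o (fun x : R => x ^+ k)).
  exact: finite_moments_integrable.
have sqrt_le x k : Num.sqrt x ^+ k <= 1 + `|x| ^+ k.
  have [x1|x1] := leP (Num.sqrt x) 1.
    by rewrite (@le_trans _ _ 1) ?exprn_ile1 ?sqrtr_ge0// lerDl exprn_ge0.
  have x0 : 0 <= x by rewrite ltW// -sqrtr_gt0 (lt_trans _ x1).
  rewrite (@le_trans _ _ (`|x| ^+ k)) ?lerDr// lerXn2r ?nnegrE ?sqrtr_ge0//.
  by rewrite ger0_norm// -[leRHS]sqr_sqrtr// expr2 ler_peMr ?sqrtr_ge0// ltW.
have msqrtX k : measurable_fun setT (fun x : R => Num.sqrt x ^+ k).
  exact: measurable_funX.
have isqrt k : Q.-integrable setT (EFin \o (fun x : R => Num.sqrt x ^+ k)).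
  have i1 : Q.-integrable setT (EFin \o cst (1 : R)).
    exact: finite_measure_integrable_cst.
  apply: le_integrable (integrableD measurableT i1 (integrable_abs_moment iQ k)) => //.
    by apply/measurable_EFinP; exact: msqrtX.
  move=> x _ /=; rewrite lee_fin ger0_norm ?exprn_ge0 ?sqrtr_ge0//.
  by rewrite [leRHS]ger0_norm ?sqrt_le// addr_ge0// exprn_ge0.
have m0 : measurable (`[0, +oo[%classic : set R) by exact: measurable_itv.
(* [Num.sqrt] is 0 on negative numbers, so [sqrt x ^ (2 k) = x ^ k] holds only up to this null
   set. *)
have Q0 : Q (~` `[0, +oo[%classic) = 0%E.
  by apply: (etrans (probability_setC Q m0)); rewrite Q1 subee.
pose nu := law Q msqrt.
have inu k : nu.-integrable setT (EFin \o (fun x : R => x ^+ k)).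
  apply: (integrable_law msqrt (g := fun x => x ^+ k)); first exact: measurable_funX.
  exact: isqrt.
have nuE k : \int[nu]_x (x ^+ k.*2) = \int[mu]_x (x ^+ k.*2).
  rewrite muE (Rintegral_law msqrt (g := fun x => x ^+ k.*2))//; last exact: isqrt.
  under [RHS]eq_Rintegral do rewrite -mul2n exprM.
  rewrite -(same_moments_Rintegral Qmom) /Rintegral; congr fine.
  apply: ae_eq_integral => //.
  - by apply/measurable_EFinP; exact: msqrtX.
  - exact: measurable_int (iQ k).
  exists (~` `[0, +oo[%classic); split.
  - exact: measurableC.
  - exact: Q0.
  - move=> x /= H; rewrite in_itv/= andbT => x0; apply: H => _.
    by rewrite -mul2n exprM sqr_sqrtr.
pose mu2 := law P (measurable_funPT ((X : {mfun T >-> R}) ^+ 2)).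
apply: (@cdf_unique _ Q mu2) => // a; rewrite lawE.
(* For [a < 0] the preimage under [Num.sqrt] is not the half-line, but both masses are 0. *)
have [a0|a0] := ltP a 0.
  rewrite (_ : _ @^-1` _ = set0); last first.
    apply/seteqP; split => w //=; rewrite leNgt => /negP; apply.
    by rewrite (lt_le_trans a0)// sqr_ge0.
  rewrite measure0; apply/eqP; rewrite -measure_le0.
  rewrite -Q0.
  apply: le_measure; rewrite ?inE.
  - by rewrite -set_itvNyc; exact: measurable_itv.
  - exact: measurableC.
  - move=> x /= xa; rewrite in_itv/= andbT => x0.
    by have := le_lt_trans xa a0; rewrite ltNge x0.
have -> : [set x : R | x <= a] = Num.sqrt @^-1` [set x | `|x| <= Num.sqrt a].
  by apply/seteqP; split => x /=; rewrite (ger0_norm (sqrtr_ge0 _)) ler_sqrt.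
rewrite -(lawE Q msqrt) (@cos_transform_norm_cdf _ nu mu)//; last first.
  move=> t.
  under eq_Rintegral do rewrite -[t * _]addr0.
  under [RHS]eq_Rintegral do rewrite -[t * _]addr0.
  apply: (cos_transform_unique C_ge0 z_gt0 z_nd z_div) => //.
  - by move=> k; rewrite nuE muE.
  - by move=> k; rewrite muE.
  - move=> n; rewrite add0r; have [/cos_odd_halfpi ->|] := boolP (odd n).
      by rewrite mul0r.
    by move/even_halfK <-; rewrite nuE subrr mulr0.
rewrite lawE; congr (P _); apply/seteqP; split => w /=.
  by rewrite sqrtr_sqr normr_id.
by rewrite sqrtr_sqr normr_id.
Qed.

(** Since [z] is non-decreasing and [D = max 1 C] satisfies [C <= D ^ (2 k)] for [k > 0], the
    [2 k]-th moment is at most [(D * z k) ^ (2 k)]; the series therefore dominates that of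
    [1 / (D * z k)]. *)
Lemma Carleman_of_moment_bound : Carleman_Hamburger P X.
Proof.
pose u (k : nat) : \bar R :=
  (('E_P[fun w => (X w ^+ (2 * k))%R] `^ (2 * k)%:R^-1%R)^-1)%E.
suff : (\sum_(1 <= k <oo) u k = +oo)%E by [].
pose D := Num.max 1 C.
have D1 : 1 <= D by rewrite le_max lexx.
have D0 : 0 < D by rewrite (lt_le_trans _ D1).
have u_ge k : (0 < k)%N -> (((D * z k)^-1)%:E <= u k)%E.
  move=> k0; rewrite /u.
  have EE : ('E_P[fun w => (X w ^+ (2 * k))%R] = (\int[P]_w (X w ^+ k.*2))%:E)%E.
    rewrite unlock /Rintegral fineK; first by rewrite mul2n.
    apply: integrable_fin_num => //.
    exact: (finite_moments_integrable (measurable_funPT X) X_moments).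
  set m := \int[P]_w (X w ^+ k.*2) in EE.
  have m0 : 0 <= m.
    apply: Rintegral_ge0 => w _.
    by rewrite -mul2n exprM exprn_ge0 ?sqr_ge0.
  rewrite inve_pge ?inE ?poweR_ge0//; last first.
    by rewrite lee_fin invr_ge0 mulr_ge0// ltW.
  rewrite inver invr_eq0 mulf_eq0 (gt_eqF D0) gt_eqF//= invrK EE poweR_EFin lee_fin.
  have Dz0 : 0 <= D * z k by rewrite mulr_ge0// ltW.
  have -> : D * z k = ((D * z k) `^ (2 * k)%:R) `^ (2 * k)%:R^-1.
    by rewrite -powRrM mulfV ?powRr1// pnatr_eq0 -lt0n muln_gt0.
  rewrite ge0_ler_powR ?nnegrE ?powR_ge0// powR_mulrn//.
  rewrite (le_trans (X_even k))// exprMn ler_pM//.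
  - by apply: prodr_ge0 => i _; rewrite sqr_ge0.
  - rewrite (@le_trans _ _ D) ?le_max ?lexx ?orbT//.
    by rewrite -[leLHS]expr1 ler_weXn2l// muln_gt0.
  - rewrite exprM -[X in _ <= _ ^+ X]card_ord -prodr_const ler_prod// => i _.
    rewrite sqr_ge0/= lerXn2r ?nnegrE; [|exact: ltW..|] => //.
    by apply: z_nd; exact: ltnW.
have u0 k : (0 <= u k)%E by rewrite inve_ge0 poweR_ge0.
apply/eqyP => A _.
(* [(z 0)^-1] makes up for the Carleman series starting at [k = 1]. *)
have [N AN] := z_div (D * A + (z 0%N)^-1).
apply: (@le_trans _ _ (\sum_(1 <= k < N) ((D * z k)^-1)%:E)%E).
  rewrite sumEFin lee_fin.
  under eq_bigr do rewrite invfM.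
  rewrite -mulr_sumr -ler_pdivrMl ?invr_gt0// invrK.
  case: N AN => [|N].
    rewrite !big_geq// => AN.
    have : 0 < (z 0%N)^-1 by rewrite invr_gt0.
    by lra.
  by rewrite big_ltn// addrC lerD2l.
apply: (@le_trans _ _ (\sum_(1 <= k < N) u k)%E).
  rewrite !big_nat; apply: lee_sum => k /andP[k1 _]; exact: u_ge.
exact: nneseries_lim_ge.
Qed.

End determinacy.

(** * Integration against a measure given by a density *)

Section density.
Import HBNNSimple.
Local Open Scope ereal_scope.
Context d (T : measurableType d) (R : realType).
Variables (nu mu : {measure set T -> \bar R}) (g : T -> R).
Hypothesis g_ge0 : forall x, (0 <= g x)%R.
Hypothesis mg : measurable_fun [set: T] g.
Hypothesis nuE : forall A, measurable A -> nu A = \int[mu]_(x in A) (g x)%:E.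

Let density_nnsfun (h : {nnsfun T >-> R}) :
  \int[nu]_x (h x)%:E = \int[mu]_x ((h x)%:E * (g x)%:E).
Proof.
have indic r : measurable_fun [set: T] (fun x => (r * \1_(h @^-1` [set r]) x)%:E).
  by apply/measurable_EFinP; exact: measurable_funM.
have mgE : measurable_fun [set: T] (EFin \o g) by exact/measurable_EFinP.
under [LHS]eq_integral do rewrite fimfunE -fsumEFin//.
rewrite ge0_integral_fsum//; last by move=> n x _; rewrite EFinM nnfun_muleindic_ge0.
under [RHS]eq_integral => x _.
  rewrite fimfunE -fsumEFin// ge0_mule_fsuml; last first.
    by move=> r; rewrite EFinM nnfun_muleindic_ge0.
  over.
rewrite [RHS]ge0_integral_fsum//; last 2 first.
- by move=> r; exact: emeasurable_funM.
- move=> n x _; rewrite mule_ge0//; last by rewrite lee_fin.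
  by rewrite EFinM nnfun_muleindic_ge0.
apply: eq_fsbigr => r; rewrite inE => -[x _ hx].
have r0 : (0 <= r)%R by rewrite -hx.
have mr : measurable (h @^-1` [set r]) by exact: measurable_sfunP.
under [RHS]eq_integral do rewrite EFinM -muleA.
under [LHS]eq_integral do rewrite EFinM.
rewrite ge0_integralZl//; last exact/measurable_EFinP.
rewrite [RHS]ge0_integralZl//; last 2 first.
- by apply: emeasurable_funM => //; exact/measurable_EFinP.
- by move=> y _; rewrite mule_ge0// lee_fin.
congr (_ * _); rewrite integral_indic// setIT nuE// [LHS]integral_mkcond.
by apply: eq_integral => y _; rewrite patchE indicE; case: ifP; rewrite ?mul1e ?mul0e.
Qed.

(** Linearity settles simple functions; monotone convergence, applied on both sides to the same
    approximation of [f], does the rest. *)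
Lemma ge0_integral_density (f : T -> R) : measurable_fun [set: T] f ->
  (forall x, (0 <= f x)%R) ->
  \int[nu]_x (f x)%:E = \int[mu]_x (f x * g x)%:E.
Proof.
move=> mf f0.
have mfE : measurable_fun [set: T] (EFin \o f) by exact/measurable_EFinP.
have mgE : measurable_fun [set: T] (EFin \o g) by exact/measurable_EFinP.
pose h := nnsfun_approx measurableT mfE.
have hf x : (h n x)%:E @[n --> \oo] --> (f x)%:E.
  by apply: (cvg_nnsfun_approx measurableT mfE) => // y _; rewrite lee_fin.
have hnd x : {homo (fun n => h n x) : m n / (m <= n)%N >-> (m <= n)%R}.
  by move=> m n mn; exact/lefP/nd_nnsfun_approx.
transitivity (limn (fun n => \int[nu]_x (h n x)%:E)).
  rewrite -monotone_convergence//.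
  - by apply: eq_integral => x _; apply/esym/cvg_lim => //; exact: hf.
  - by move=> n; exact/measurable_EFinP.
  - by move=> n x _; rewrite lee_fin.
  - by move=> x _ m n mn; rewrite lee_fin hnd.
transitivity (limn (fun n => \int[mu]_x ((h n x)%:E * (g x)%:E))).
  by congr (limn _); apply/funext => n; exact: density_nnsfun.
rewrite -monotone_convergence//.
- apply: eq_integral => x _; rewrite EFinM; apply/cvg_lim => //.
  by apply: cvgeZr => //; exact: hf.
- by move=> n; apply: emeasurable_funM => //; exact/measurable_EFinP.
- by move=> n x _; rewrite mule_ge0 ?lee_fin.
- by move=> x _ m n mn; rewrite lee_wpmul2r ?lee_fin// hnd.
Qed.

End density.

(** * The inverse square on two-sided tails *)

Section tails.
Context {R : realType}.
Local Notation leb := (@lebesgue_measure R).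

Lemma tailE (a : R) :
  [set x | a <= `|x|] = `]-oo, - a]%classic `|` `[a, +oo[%classic.
Proof.
apply/seteqP; split => x /=; rewrite !in_itv/= andbT.
  by rewrite ler_normr lerNr orbC => /orP.
by rewrite ler_normr lerNr orbC => /orP.
Qed.

Lemma measurable_tail (a : R) : measurable [set x : R | a <= `|x|].
Proof. by rewrite tailE; apply: measurableU; exact: measurable_itv. Qed.

Lemma measurable_invr_sqr : measurable_fun setT (fun x : R => (x ^+ 2)^-1).
Proof.
rewrite (_ : (fun x => _) = (fun x : R => powR (x ^+ 2) (-1))).
  by apply: (measurableT_comp (measurable_powR (-1))); exact: measurable_funX.
by apply/funext => x; rewrite powR_inv1// sqr_ge0.
Qed.

Lemma integral_itv_invr_sqr (a : R) : 0 < a ->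
  (\int[leb]_(x in `[a, +oo[) ((x ^+ 2)^-1)%:E = (a^-1)%:E)%E.
Proof.
move=> a0; rewrite (@ge0_continuous_FTC2y _ _ (fun x => - x^-1) _ 0).
- by rewrite EFinN oppeK add0e.
- by move=> x _; rewrite invr_ge0 sqr_ge0.
- apply: continuous_in_subspaceT => x; rewrite inE/= in_itv/= andbT => ax.
  apply: cvgV; first by rewrite sqrf_eq0 gt_eqF// (lt_le_trans a0).
  exact: exprn_continuous.
- rewrite -oppr0; apply: cvgN; apply: (gtr0_cvgV0 _).2; last exact: cvg_id.
  exact: nbhs_pinfty_gt.
- move=> x ax; apply: derivableN; apply: derivableV => //.
  by rewrite gt_eqF// (lt_trans a0).
- apply: cvg_at_right_filter; apply: cvgN; apply: cvgV => //.
  by rewrite gt_eqF.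
- move=> x; rewrite in_itv/= andbT => ax.
  have x0 : x != 0 by rewrite gt_eqF// (lt_trans a0).
  rewrite derive1E deriveN; last exact: derivableV.
  by rewrite deriveV// derive_id scaleNr opprK [LHS]mulr1.
Qed.

Lemma integral_tail_invr_sqr (a : R) : 0 < a ->
  (\int[leb]_(x in [set x | (a <= `|x|)%R]) ((x ^+ 2)^-1)%:E = (2 / a)%:E)%E.
Proof.
move=> a0; rewrite tailE ge0_integral_setU//=.
- rewrite ge0_integration_by_substitutionNy.
  + under [X in (X + _)%E]eq_integral do rewrite /= sqrrN.
    by rewrite !integral_itv_invr_sqr// -EFinD; congr EFin; ring.
  + apply: continuous_in_subspaceT => x; rewrite inE/= in_itv/= => xa.
    apply: cvgV; last exact: exprn_continuous.
    by rewrite sqrf_eq0 lt_eqF//; lra.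
  + by move=> x _; rewrite invr_ge0 sqr_ge0.
- by apply/measurable_EFinP/measurable_funTS; exact: measurable_invr_sqr.
- by move=> x _; rewrite lee_fin invr_ge0 sqr_ge0.
- apply/disj_setPS => x [] /=; rewrite !in_itv/= andbT => xa ax.
  by have := le_trans ax xa; lra.
Qed.

End tails.

(** * Levels of [- ln f / ln] and the bound on powers times the density *)

Section levels.
Context {R : realType} (f : R -> R) (x0 : R).
Hypothesis x0_gt1 : 1 < x0.
Hypothesis fpos : forall x, x0 <= x -> 0 < f x.

Let q (x : R) : R := - ln (f x) / ln x.

Hypothesis q_nd : {in `[x0, +oo[ &, {homo q : x y / x <= y}}.
Hypothesis q_pinfty : q x @[x --> +oo] --> +oo.

Let ge_x0 x : (x \in `[x0, +oo[) = (x0 <= x).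
Proof. by rewrite in_itv/= andbT. Qed.

Let ln_gt0x x : x0 <= x -> 0 < ln x.
Proof. by move=> x0x; rewrite ln_gt0// (lt_le_trans x0_gt1). Qed.

(** The exponent is [2 * (k + 1)], for the moment of that order, plus 2, for integrability at
    infinity: on this set [x ^ (2 k + 4) * f x <= 1]. *)
Definition level k : set R := [set x | x0 <= x /\ 2 * k%:R + 4 <= q x].

Definition level_inf k := inf (level k).

Let level_has_inf k : has_inf (level k).
Proof.
split; last by exists x0 => x [].
have /cvgryPge/(_ (2 * k%:R + 4)) h := q_pinfty.
near +oo_R => x; exists x; split.
  by near: x; apply: nbhs_pinfty_ge; exact: num_real.
by near: x.
Unshelve. all: by end_near. Qed.

Lemma level_inf_ge k : x0 <= level_inf k.
Proof. by apply: lb_le_inf; [case: (level_has_inf k)|move=> x []]. Qed.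

Lemma level_inf_gt0 k : 0 < level_inf k.
Proof. by rewrite (lt_le_trans _ (level_inf_ge k))// (lt_trans _ x0_gt1). Qed.

Lemma level_inf_le k x : x0 <= x -> 2 * k%:R + 4 <= q x -> level_inf k <= x.
Proof. by move=> x0x qx; apply: ge_inf; [exists x0 => y []|]. Qed.

(** [level k] is upward closed because [q] is non-decreasing; the infimum itself need not belong to
    it, hence the strict inequality. *)
Lemma level_inf_lt k x : level_inf k < x -> 2 * k%:R + 4 <= q x.
Proof.
move=> /(inf_lt (level_has_inf k).1)[y [x0y qy] yx].
by rewrite (le_trans qy)// q_nd ?ge_x0// ?(le_trans x0y)// ltW.
Qed.

Lemma level_inf_nd : {homo level_inf : m n / (m <= n)%N >-> m <= n}.
Proof.
move=> m n mn; apply: lb_le_inf; first by case: (level_has_inf n).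
move=> x [x0x qx]; apply: level_inf_le => //; apply: le_trans qx.
by rewrite lerD2r ler_pM2l// ler_nat.
Qed.

Let pow_le n x : x0 <= x -> n%:R <= q x -> x ^+ n * f x <= 1.
Proof.
move=> x0x nq; have fx := fpos x0x; have lx := ln_gt0x x0x.
have xp : 0 < x by rewrite (lt_le_trans _ x0x)// (lt_trans _ x0_gt1).
rewrite -ler_ln ?posrE ?mulr_gt0 ?exprn_gt0// ln1.
rewrite lnM ?posrE ?exprn_gt0// lnXn// -mulr_natl.
by move: nq; rewrite /q ler_pdivlMr// => nq; lra.
Qed.

(** Induction on [k]. Beyond [level_inf k] the left side of the next case is at most 1, and the
    right side at least 1 because all levels exceed 1; up to [level_inf k] the two extra powers of
    [x] cost at most [level_inf k ^ 2]. *)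
Lemma level_bound : exists D, 1 <= D /\ forall k x, x0 <= x ->
  x ^+ k.+1.*2 * f x <= D * \prod_(i < k) level_inf i ^+ 2.
Proof.
(* Bounds [x ^ 2 * f x] between [x0] and [level_inf 0], where [f x = expR (- q x * ln x)] and
   [q x >= q x0]. *)
pose b := level_inf 0 ^+ 2 * expR (`|q x0| * ln (level_inf 0)).
exists (Num.max 1 b); set D := Num.max 1 b.
have D1 : 1 <= D by rewrite le_max lexx.
split=> // k x x0x; have fx := fpos x0x.
have xp : 1 <= x by rewrite (le_trans _ x0x)// ltW.
have prod1 n : 1 <= \prod_(i < n) level_inf i ^+ 2.
  elim: n => [|n IH]; first by rewrite big_ord0.
  rewrite big_ord_recr/= (le_trans IH)// ler_peMr//; first exact: le_trans IH.
  by rewrite exprn_ege1// (le_trans _ (level_inf_ge n))// ltW.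
have Dp1 n : 1 <= D * \prod_(i < n) level_inf i ^+ 2.
  by rewrite (le_trans D1)// ler_peMr// (le_trans _ D1).
elim: k => [|k IH].
  rewrite big_ord0 mulr1; have [xz|zx] := leP x (level_inf 0).
    rewrite (@le_trans _ _ b) ?le_max ?lexx ?orbT// ler_pM//.
    - by rewrite exprn_ge0// (le_trans _ xp).
    - exact: ltW.
    - by rewrite lerXn2r ?nnegrE ?(le_trans _ xp)// ltW// level_inf_gt0.
    rewrite -[f x]lnK ?posrE// ler_expR.
    have -> : ln (f x) = - q x * ln x.
      by rewrite /q; field; rewrite gt_eqF// ln_gt0x.
    have lx := ln_gt0x x0x.
    apply: (@le_trans _ _ (`|q x0| * ln x)).
      rewrite ler_wpM2r//; first exact: ltW.
      have := @q_nd x0 x; rewrite !ge_x0 lexx x0x => /(_ isT isT isT) qx.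
      by rewrite -normrN (le_trans _ (ler_norm _))// lerN2.
    by rewrite ler_wpM2l// ler_ln// posrE ?level_inf_gt0// (lt_le_trans _ xp).
  rewrite (le_trans _ D1)// (le_trans _ (@pow_le 4 _ x0x _))//.
    rewrite ler_pM2r//; exact: ler_weXn2l.
  by have := level_inf_lt zx; rewrite mulr0 add0r.
have [xz|zx] := leP x (level_inf k).
  have x_ge0 : 0 <= x by rewrite (le_trans _ xp).
  have -> : x ^+ k.+2.*2 * f x = x ^+ 2 * (x ^+ k.+1.*2 * f x).
    by rewrite [RHS]mulrA -exprD.
  rewrite big_ord_recr/= [D * _]mulrA [leRHS]mulrC; apply: ler_pM.
  - exact: sqr_ge0.
  - by rewrite mulr_ge0 ?exprn_ge0// ltW.
  - by rewrite lerXn2r// nnegrE ltW// level_inf_gt0.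
  - exact: IH.
rewrite (le_trans _ (Dp1 _))// pow_le//.
have := level_inf_lt zx; rewrite -mul2n natrM -[k.+2]addn2 natrD.
by lra.
Qed.

End levels.

(** * Divergence of the sum of inverse levels *)

Section density_levels.
Context {R : realType} (f : R -> R) (x0 : R).
Local Notation leb := (@lebesgue_measure R).
Local Notation z := (level_inf f x0).
Hypothesis x0_gt1 : 1 < x0.
Hypothesis mf : measurable_fun [set: R] f.
Hypothesis fsym : forall x, f (- x) = f x.
Hypothesis flim : (fun x => - ln (f x) / ln x) x @[x --> +oo] --> +oo.

Let f_norm x : f `|x| = f x.
Proof. by have [_|_] := ler0P x. Qed.

Let x0_gt0 : 0 < x0. Proof. exact: lt_trans x0_gt1. Qed.

Let z_gt0 := level_inf_gt0 x0_gt1 flim.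

(** The least [N] satisfying the first inequality works: for [k < N], minimality gives
    [2 * k + 4 < q], so [y] lies in [level k]. *)
Let count_levels (y : R) : x0 <= y -> exists N,
  - ln (f y) / ln y <= 2 * N%:R + 4 /\ forall k, (k < N)%N -> z k <= y.
Proof.
move=> x0y; set q := - ln (f y) / ln y.
have ex : exists N, q <= 2 * N%:R + 4.
  exists (Num.bound `|q|); have := archi_boundP (normr_ge0 q).
  by have := ler_norm q; have := normr_ge0 q; lra.
exists (ex_minn ex); case: ex_minnP => N qN minN; split=> // k kN.
apply: level_inf_le => //; rewrite leNgt; apply/negP => /ltW /minN.
by rewrite leqNgt kN.
Qed.

(** If the partial sums stayed below [A], the integrand would be dominated through [count_levels] by
    a function [h] whose integral, by Tonelli, is at most [8 / x0 + 4 * A]: the indicator of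
    [z k <= |x|] contributes [4 / z k]. *)
Theorem level_inf_div :
  (\int[leb]_(x in [set x : R | (x0 <= `|x|)%R])
     (- ln (f x) / (x ^+ 2 * ln `|x|))%R%:E = +oo)%E ->
  forall A, exists N, A <= \sum_(0 <= i < N) (z i)^-1.
Proof.
move=> fint A; apply: contrapT => /forallNP noN.
set D := [set x : R | x0 <= `|x|] in fint.
set phi := (fun x : R => _) in fint.
have mD : measurable D := measurable_tail x0.
have Dz k : [set x : R | z k <= `|x|] `<=` D.
  by move=> x /=; apply: le_trans; exact: level_inf_ge.
pose h (x : R) : \bar R := ((4 * (x ^+ 2)^-1)%:E +
  \sum_(k <oo) (2 * (x ^+ 2)^-1 * \1_[set x | (z k <= `|x|)%R] x)%:E)%E.
have inv0 (x : R) : 0 <= (x ^+ 2)^-1 by rewrite invr_ge0 sqr_ge0.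
have t0 k (x : R) : 0 <= 2 * (x ^+ 2)^-1 * \1_[set x | (z k <= `|x|)%R] x.
  by rewrite !mulr_ge0.
have mt k : measurable_fun setT
    (fun x : R => 2 * (x ^+ 2)^-1 * \1_[set x | (z k <= `|x|)%R] x).
  apply: measurable_funM.
    by apply: measurable_funM => //; exact: measurable_invr_sqr.
  by apply: measurable_indic; exact: measurable_tail.
have h0 x : (0 <= h x)%E.
  rewrite adde_ge0// ?lee_fin ?mulr_ge0//.
  by apply: nneseries_ge0 => k _ _; rewrite lee_fin.
have mh1 : measurable_fun setT (fun x : R => 4 * (x ^+ 2)^-1).
  by apply: measurable_funM => //; exact: measurable_invr_sqr.
have mh2 : measurable_fun setT (fun x : R =>
    \sum_(k <oo) (2 * (x ^+ 2)^-1 * \1_[set x | (z k <= `|x|)%R] x)%:E)%E.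
  apply: ge0_emeasurable_sum => [k x _ _|k _]; first by rewrite lee_fin.
  exact/measurable_EFinP.
have mh : measurable_fun D h.
  apply: measurable_funTS; apply: emeasurable_funD => //.
  exact/measurable_EFinP.
have int_h : (\int[leb]_(x in D) h x < +oo)%E.
  rewrite ge0_integralD//; last 4 first.
  - by move=> x _; rewrite lee_fin mulr_ge0.
  - exact/measurable_EFinP/measurable_funTS.
  - by move=> x _; apply: nneseries_ge0 => k _ _; rewrite lee_fin.
  - exact: measurable_funTS.
  rewrite integral_nneseries//; last 2 first.
  - by move=> k; apply/measurable_EFinP; exact: measurable_funTS (mt k).
  - by move=> k x _; rewrite lee_fin.
  have intZ (c a : R) : 0 <= c -> 0 < a ->
      (\int[leb]_(x in [set x | (a <= `|x|)%R]) (c * (x ^+ 2)^-1)%:E =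
       (c * (2 / a))%:E)%E.
    move=> c0 a0; under eq_integral do rewrite EFinM.
    rewrite ge0_integralZl//; first by rewrite integral_tail_invr_sqr.
    - exact: measurable_tail.
    - by apply/measurable_EFinP/measurable_funTS; exact: measurable_invr_sqr.
    - by move=> x _; rewrite lee_fin.
  rewrite (intZ 4 x0)//.
  have -> : (\sum_(k <oo) \int[leb]_(x in D)
      (2 * (x ^+ 2)^-1 * \1_[set x | (z k <= `|x|)%R] x)%:E =
      \sum_(k <oo) (4 / z k)%:E)%E.
    apply: eq_eseriesr => k _.
    transitivity (\int[leb]_(x in D)
        ((fun x : R => (2 * (x ^+ 2)^-1)%:E) \_ [set x | (z k <= `|x|)%R]) x)%E;
      last first.
      rewrite -integral_mkcondr setIidr// (intZ 2 (z k))//.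
      by rewrite mulrA -natrM.
    apply: eq_integral => x _; rewrite patchE indicE; case: ifP => _.
      by rewrite mulr1.
    by rewrite mulr0.
  rewrite (@le_lt_trans _ _ ((4 * (2 / x0))%:E + (4 * A)%:E)%E) ?ltry//.
  rewrite leeD2l//; apply: lime_le.
    by apply: is_cvg_nneseries => k _ _; rewrite lee_fin divr_ge0// ltW.
  apply: nearW => N; rewrite sumEFin lee_fin -mulr_sumr ler_pM2l//.
  by rewrite leNgt; apply/negP => /ltW /noN.
have mphi : measurable_fun D phi.
  apply/measurable_EFinP.
  apply: (eq_measurable_fun (fun x => - ln (f x) * powR (x ^+ 2 * ln `|x|) (-1))).
    move=> x; rewrite inE /D/= => x0x; rewrite powR_inv1// mulr_ge0 ?sqr_ge0//.
    by rewrite ln_ge0// (le_trans _ x0x)// ltW.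
  apply: measurable_funTS; apply: measurable_funM.
    by apply: measurableT_comp => //; apply: measurableT_comp mf; exact: measurable_ln.
  apply: (measurableT_comp (measurable_powR (-1))); apply: measurable_funM.
    exact: measurable_funX.
  apply: measurableT_comp; first exact: measurable_ln.
  exact: normr_measurable.
have phi_h x : D x -> (phi x <= h x)%E.
  move=> x0x; have [N [qN zN]] := count_levels x0x.
  have := ler_wpM2r (inv0 x) qN; rewrite f_norm.
  have -> : - ln (f x) / ln `|x| * (x ^+ 2)^-1 = - ln (f x) / (x ^+ 2 * ln `|x|).
    by rewrite mulrAC [(_ * ln _)^-1]invfM mulrA.
  rewrite -lee_fin => /le_trans; apply.
  rewrite mulrDl addrC EFinD leeD2l//.
  apply: (@le_trans _ _ (\sum_(0 <= k < N)
      (2 * (x ^+ 2)^-1 * \1_[set x | (z k <= `|x|)%R] x)%:E)%E); last first.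
    by apply: nneseries_lim_ge => k _ _; rewrite lee_fin.
  rewrite sumEFin lee_fin le_eqVlt; apply/orP; left; apply/eqP.
  rewrite (eq_big_nat _ _ (F2 := fun=> 2 * (x ^+ 2)^-1)); last first.
    by move=> k /andP[_ kN]; rewrite indicE mem_set ?mulr1//=; exact: zN.
  by rewrite sumr_const_nat subn0 -mulr_natr; ring.
have : (\int[leb]_(x in D) phi x < +oo)%E.
  (* [phi] may be negative where [f > 1]; the negative part only lowers the integral, so its
     positive part alone is compared with [h]. *)
  rewrite integralE (le_lt_trans _ int_h)//.
  rewrite (@le_trans _ _ (\int[leb]_(x in D) phi^\+ x)%E)//.
    by rewrite geeDl// oppe_le0; apply: integral_ge0.
  apply: ge0_le_integral => //.
  - exact: measurable_funepos.
  - by move=> x Dx; rewrite funeposE ge_max h0 phi_h.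
by rewrite fint ltxx.
Qed.

End density_levels.

(** * Even moments from the density, and conclusion *)

Lemma density_even_moment_le d (T : measurableType d) (R : realType)
    (P : probability T R) (X : {RV P >-> R}) (f : R -> R) (x0 B : R) k :
  finite_moments P X -> has_density P X f -> (forall x, f (- x) = f x) ->
  0 < x0 -> 0 <= B ->
  (forall x, x0 <= x -> x ^+ k.+1.*2 * f x <= B) ->
  \int[P]_w (X w ^+ k.*2) <= x0 ^+ k.*2 + 2 / x0 * B.
Proof.
move=> Xfin [mf f0 Xf] fsym x0_gt0 B0 fB.
have mX := measurable_funPT X.
have even (x : R) : x ^+ k.*2 = `|x| ^+ k.*2.
  by rewrite -mul2n !exprM -normrX ger0_norm ?sqr_ge0.
have even0 (x : R) : 0 <= x ^+ k.*2 by rewrite even exprn_ge0.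
have lawf A : measurable A -> law P mX A = (\int[lebesgue_measure]_(x in A) (f x)%:E)%E.
  by move=> mA; rewrite -Xf.
have mpow : measurable_fun setT (fun x : R => x ^+ k.*2) by exact: measurable_funX.
rewrite -(Rintegral_law mX (g := fun x => x ^+ k.*2))//; last first.
  exact: (finite_moments_integrable mX Xfin).
have fin : (\int[law P mX]_x (x ^+ k.*2)%:E)%E \is a fin_num.
  apply: integrable_fin_num => //.
  apply: (integrable_law mX (g := fun x => x ^+ k.*2)) => //.
  exact: (finite_moments_integrable mX Xfin).
rewrite -lee_fin /Rintegral fineK//.
rewrite (@ge0_integral_density _ (measurableTypeR R) R _ _ f f0 mf lawf)//.
have inv0 (x : R) : 0 <= (x ^+ 2)^-1 by rewrite invr_ge0 sqr_ge0.
set S := [set x : R | x0 <= `|x|].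
have mS : measurable S := measurable_tail x0.
(* [h1] dominates [x ^ (2 k) * f x] where [|x| < x0] and has integral [x0 ^ (2 k)]; [h2] dominates
   it elsewhere and has integral [2 / x0 * B]. *)
pose h1 (x : R) := x0 ^+ k.*2 * f x.
pose h2 (x : R) := B * ((x ^+ 2)^-1 * \1_S x).
have mh1 : measurable_fun setT h1 by apply: measurable_funM.
have mh2 : measurable_fun setT h2.
  apply: measurable_funM => //; apply: measurable_funM; first exact: measurable_invr_sqr.
  exact: measurable_indic.
have h10 x : 0 <= h1 x by rewrite mulr_ge0// exprn_ge0// ltW.
have h20 x : 0 <= h2 x by rewrite !mulr_ge0.
apply: (@le_trans _ _ (\int[lebesgue_measure]_x ((h1 x)%:E + (h2 x)%:E)))%E.
  apply: ge0_le_integral => //.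
  - by move=> x _; rewrite lee_fin mulr_ge0.
  - by apply/measurable_EFinP; exact: measurable_funM.
  - by apply: emeasurable_funD; exact/measurable_EFinP.
  move=> x _; rewrite -EFinD lee_fin; have [xx0|x0x] := ltP `|x| x0.
    rewrite (@le_trans _ _ (h1 x)) ?lerDl// ler_wpM2r// even.
    by rewrite lerXn2r ?nnegrE//; exact: ltW.
  rewrite (@le_trans _ _ (h2 x)) ?lerDr// /h2 indicE mem_set//= mulr1.
  have x_gt0 : 0 < x ^+ 2.
    by rewrite -real_normK ?num_real// exprn_gt0// (lt_le_trans x0_gt0).
  rewrite ler_pdivlMr//.
  have := fB _ x0x; have -> : f `|x| = f x by have [_|_] := ler0P x.
  have -> : `|x| ^+ k.+1.*2 = `|x| ^+ k.*2 * `|x| ^+ 2.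
    by rewrite -exprD doubleS addn2.
  by rewrite -even real_normK ?num_real// mulrAC.
rewrite ge0_integralD//; last 4 first.
- by move=> x _; rewrite lee_fin.
- exact/measurable_EFinP.
- by move=> x _; rewrite lee_fin.
- exact/measurable_EFinP.
rewrite EFinD leeD//.
  under eq_integral do rewrite EFinM.
  rewrite ge0_integralZl//; last 3 first.
  - exact/measurable_EFinP.
  - by move=> x _; rewrite lee_fin.
  - by rewrite lee_fin exprn_ge0// ltW.
  by rewrite -lawf// probability_setT mule1.
under eq_integral do rewrite EFinM.
rewrite ge0_integralZl//; last 2 first.
- apply/measurable_EFinP; apply: measurable_funM; first exact: measurable_invr_sqr.
  exact: measurable_indic.
- by move=> x _; rewrite lee_fin mulr_ge0.
rewrite mulrC EFinM -(integral_tail_invr_sqr x0_gt0) [X in (_ <= _ * X)%E]integral_mkcond.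
rewrite le_eqVlt; apply/orP; left; apply/eqP; congr (_ * _)%E.
apply: eq_integral => x _; rewrite patchE indicE; case: ifP; rewrite ?mulr1 ?mulr0//.
Qed.

Theorem theorem1 (d : measure_display) (T : measurableType d) (R : realType)
    (P : probability T R) (X : {RV P >-> R}) (f : R -> R) (x0 : R)
    (Xmoments : finite_moments P X)
    (Xf : has_density P X f)
    (fsym : forall x, f (- x) = f x)
    (x0_gt1 : 1 < x0)
    (fcont : {within [set x : R | x0 <= `|x|], continuous f})
    (fpos : forall x, x0 <= `|x| -> 0 < f x)
    (fint : (\int[@lebesgue_measure R]_(x in [set x : R | (x0 <= `|x|)%R])
               (- ln (f x) / (x ^+ 2 * ln `|x|))%R%:E = +oo)%E)
    (fmono : {in `[x0, +oo[ &,
               {homo (fun x => - ln (f x) / ln x) : x y / x <= y}})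
    (flim : (fun x => - ln (f x) / ln x) x @[x --> +oo] --> +oo) :
  [/\ Carleman_Hamburger P X,
      M_determinate P X &
      M_determinate_nneg P ((X : {mfun T >-> R}) ^+ 2)].
Proof.
have x0_gt0 : 0 < x0 by exact: lt_trans x0_gt1.
have fpos' x : x0 <= x -> 0 < f x.
  by move=> x0x; apply: fpos; rewrite (le_trans x0x)// ler_norm.
have [mf f0 _] := Xf.
have z_gt0 := level_inf_gt0 x0_gt1 flim.
have z_nd := level_inf_nd x0 flim.
have z_div := level_inf_div x0_gt1 mf fsym flim fint.
have [D [D1 fD]] := level_bound x0_gt1 fpos' fmono flim.
have D0 : 0 <= D by rewrite (le_trans _ D1).
(* The 1 absorbs [x0 ^ (2 k)], which is at most the product of the squared levels since each level
   is at least [x0]; the rest is the tail term with [B] equal to [D] times that product. *)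
pose C := 1 + 2 / x0 * D.
have C0 : 0 <= C by rewrite addr_ge0// mulr_ge0// divr_ge0// ltW.
have X_even k : \int[P]_w (X w ^+ k.*2) <=
    C * \prod_(i < k) level_inf f x0 i ^+ 2.
  have prod0 : 0 <= \prod_(i < k) level_inf f x0 i ^+ 2.
    by apply: prodr_ge0 => i _; exact: sqr_ge0.
  apply: le_trans (density_even_moment_le Xmoments Xf fsym x0_gt0 _ (fD k)) _.
    exact: mulr_ge0.
  set z2 := \prod_(i < k) _.
  have -> : C * z2 = z2 + 2 / x0 * (D * z2) by rewrite /C; ring.
  rewrite lerD2r.
  rewrite -mul2n exprM -[X in _ ^+ X <= _]card_ord -prodr_const.
  apply: ler_prod => i _; rewrite sqr_ge0/= lerXn2r ?nnegrE//.
  - exact: ltW.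
  - exact: ltW.
  - exact: (level_inf_ge x0 flim).
split.
- exact: (Carleman_of_moment_bound C0 z_gt0 z_nd z_div Xmoments X_even).
- exact: (M_determinate_of_moment_bound C0 z_gt0 z_nd z_div Xmoments X_even).
- exact: (M_determinate_nneg_sqr_of_moment_bound C0 z_gt0 z_nd z_div Xmoments X_even).
Qed.
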